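(* Let $\mathbf{G}$ be the transfer function of a minimal strictly proper LTI plant and let $\mathbf{K}$ be a minimal $n$-th order dynamic controller that internally stabilizes $\mathbf{G}$. Write $\mathbf{K}=\mathbf{K}_<+\mathbf{K}_\ge$, where $\mathbf{K}_<$ contains the poles of $\mathbf{K}$ in the open left-half plane and $\mathbf{K}_\ge$ those in the closed right-half plane. Let $\mathbf{K}_{r,<}$ be a lower-order approximation of $\mathbf{K}_<$ obtained by the modal truncation algorithm, and let $\mathbf{K}_r:=\mathbf{K}_{r,<}+\mathbf{K}_\ge$. Denote $\mathbf{\Delta}=\mathbf{K}_<-\mathbf{K}_{r,<}$, and suppose that $$\|\mathbf{\Delta}\|_{\mathcal{H}_\infty}<\frac{1}{\|(I-\mathbf{G}\mathbf{K})^{-1}\mathbf{G}\|_{\mathcal{H}_\infty}}.$$ Then $\mathbf{K}_r$ internally stabilizes $\mathbf{G}$, and the resulting LQG cost satisfies $$J(\mathbf{K}_r)\le\frac{1}{\left(1-\|\mathbf{X}\|_{\mathcal{H}_\infty}\|\mathbf{\Delta}\|_{\mathcal{H}_\infty}\right)^2}\,\bigl(J(\mathbf{K})+S_1+S_2\bigr),$$ where $\mathbf{Y}:=(I-\mathbf{G}\mathbf{K})^{-1}$, $\mathbf{X}:=(I-\mathbf{G}\mathbf{K})^{-1}\mathbf{G}$, and $$S_1:=2\|\mathbf{\Delta}\|_{\mathcal{H}_\infty}\|\mathbf{X}\|_{\mathcal{H}_2}\|\mathbf{X}\mathbf{K}\|_{\mathcal{H}_2}+2\|\mathbf{\Delta}\|_{\mathcal{H}_2}\bigl(\|\mathbf{K}\mathbf{Y}\|_{\mathcal{H}_2}\|\mathbf{Y}\|_{\mathcal{H}_\infty}+\|\mathbf{K}\mathbf{X}\|_{\mathcal{H}_2}\|\mathbf{X}\|_{\mathcal{H}_\infty}\bigr)\bigl(1+\|\mathbf{K}\mathbf{X}\|_{\mathcal{H}_\infty}\bigr),$$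 $$S_2:=\|\mathbf{\Delta}\|_{\mathcal{H}_\infty}^2\|\mathbf{X}\|_{\mathcal{H}_2}^2+\|\mathbf{\Delta}\|_{\mathcal{H}_2}^2\bigl(\|\mathbf{Y}\|_{\mathcal{H}_\infty}^2+\|\mathbf{X}\|_{\mathcal{H}_\infty}^2\bigr)\bigl(1+\|\mathbf{K}\mathbf{X}\|_{\mathcal{H}_\infty}\bigr)^2.$$
   Context: Plant: $\dot x=Ax+Bu+Bw$, $y=Cx+v$, with real matrices, $x(t)\in\mathbb{R}^{n_x}$, $u(t),w(t)\in\mathbb{R}^m$, $y(t),v(t)\in\mathbb{R}^p$; the plant is minimal, i.e. $(A,B)$ is controllable and $(C,A)$ is observable. Its transfer function is $\mathbf{G}(s)=C(sI-A)^{-1}B$. The signals $w$ and $v$ are zero-mean Gaussian white noises, each with spectrum equal to the identity. Dynamic controller: $\dot\xi=A_K\xi+B_Ky$, $u=C_K\xi$, with real matrices; it is identified with the strictly proper real-rational transfer function $\mathbf{K}(s)=C_K(sI-A_K)^{-1}B_K$, represented by a minimal realization; its order is the dimension of $\xi$. Feedback sign convention: $\mathbf{u}=\mathbf{K}\mathbf{y}$. A controller $\mathbf{K}$ internally stabilizes $\mathbf{G}$ if the closed-loop matrix $\begin{bmatrix}A & BC_K\\ B_KC & A_K\end{bmatrix}$ has all eigenvalues in the open left-half plane; equivalently, if $(I-\mathbf{G}\mathbf{K})^{-1}\mathbf{G}$, $(I-\mathbf{G}\mathbf{K})^{-1}\mathbf{G}\mathbf{K}$, $\mathbf{K}(I-\mathbf{G}\mathbf{K})^{-1}\mathbf{G}$,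 $\mathbf{K}(I-\mathbf{G}\mathbf{K})^{-1}$ all belong to $\mathcal{RH}_\infty$, the set of real-rational proper transfer matrices with all poles in the open left-half plane (''stable''). For stable $\mathbf{F}$, $\|\mathbf{F}\|_{\mathcal{H}_\infty}=\sup_{\omega\in\mathbb{R}}\sigma_{\max}(\mathbf{F}(j\omega))$; for stable strictly proper $\mathbf{F}$, $\|\mathbf{F}\|_{\mathcal{H}_2}=\sqrt{\frac{1}{2\pi}\int_{-\infty}^{\infty}\mathrm{Tr}(\mathbf{F}(-j\omega)^{\mathsf T}\mathbf{F}(j\omega))\,d\omega}$. The (normalized) LQG cost of an internally stabilizing controller is $J(\mathbf{K})=\lim_{T\to\infty}\mathbb{E}\left[\frac1T\int_0^T x(t)^{\mathsf T}C^{\mathsf T}Cx(t)+u(t)^{\mathsf T}u(t)\,dt\right]$, which equals $$\|(I-\mathbf{G}\mathbf{K})^{-1}\mathbf{G}\|_{\mathcal{H}_2}^2+\|(I-\mathbf{G}\mathbf{K})^{-1}\mathbf{G}\mathbf{K}\|_{\mathcal{H}_2}^2+\|\mathbf{K}(I-\mathbf{G}\mathbf{K})^{-1}\mathbf{G}\|_{\mathcal{H}_2}^2+\|\mathbf{K}(I-\mathbf{G}\mathbf{K})^{-1}\|_{\mathcal{H}_2}^2.$$ Stable/unstable separation: by a real invertible change of coordinates, $A_K$ is brought to the form $\mathrm{diag}(\hat A_<,\hat A_\ge)$, where $\hat A_<$ has all eigenvalues in the open left-half plane and $\hat A_\ge$ has all eigenvalues in the closed right-half plane; with $B_K$, $C_K$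 transformed and partitioned conformally, $\mathbf{K}_<(s)=\hat C_<(sI-\hat A_<)^{-1}\hat B_<$ and $\mathbf{K}_\ge(s)=\hat C_\ge(sI-\hat A_\ge)^{-1}\hat B_\ge$. Modal truncation algorithm applied to the stable system $\mathbf{K}_<$: bring $\hat A_<$ to Jordan normal form $\mathrm{diag}(A_1,\dots,A_k)$, $A_i$ being Jordan blocks, and partition the input and output matrices conformally, so that $\mathbf{K}_<(s)=\sum_{i=1}^kC_i(sI-A_i)^{-1}B_i$. Put $d_i=\|C_i(sI-A_i)^{-1}B_i\|_{\mathcal{H}_\infty}$. For a given positive integer $r_{\mathrm{red}}<k$, remove from the sum the $r_{\mathrm{red}}$ blocks with the smallest $d_i$; the remaining sum is $\mathbf{K}_{r,<}$. As a controller, $\mathbf{K}_r$ is understood to have real coefficients. *)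

(* Defs.v *)
From HB Require Import structures.
From mathcomp Require Import all_boot all_order all_algebra.
From mathcomp Require Import fraction generic_quotient.
From mathcomp Require Import all_classical all_reals all_analysis.
From mathcomp Require Import complex.

Set Implicit Arguments.
Unset Strict Implicit.
Unset Printing Implicit Defensive.

Import Order.TTheory GRing.Theory Num.Theory.
Local Open Scope classical_set_scope.
Local Open Scope ring_scope.

(* x' = A x + B u, y = C x, with n states, m inputs and p outputs. *)
Record system (F : Type) (n m p : nat) := System {
  sysA : 'M[F]_n;
  sysB : 'M[F]_(n, m);
  sysC : 'M[F]_(p, n) }.

Section Systems.
Variable F : fieldType.

Definition controllable n m (A : 'M[F]_n) (B : 'M[F]_(n, m)) : Prop :=
  \rank (\mxrow_(j < n) (A ^+ j *m B)) = n.

Definition observable n p (C : 'M[F]_(p, n)) (A : 'M[F]_n) : Prop :=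
  \rank (\mxcol_(i < n) (C *m A ^+ i)) = n.

Definition minimal n m p (S : system F n m p) : Prop :=
  controllable (sysA S) (sysB S) /\ observable (sysC S) (sysA S).

(* The state dimensions are kept syntactically independent (although they must
   be equal) so that block-structured S' need no casts. *)
Definition similar n n' m p (S : system F n m p) (S' : system F n' m p) : Prop :=
  exists (T : 'M[F]_(n', n)) (Ti : 'M[F]_(n, n')),
    [/\ T *m Ti = 1%:M, Ti *m T = 1%:M
      & System (T *m sysA S *m Ti) (T *m sysB S) (sysC S *m Ti) = S'].

Definition parallel n1 n2 m p (S1 : system F n1 m p) (S2 : system F n2 m p) :
    system F (n1 + n2) m p :=
  System (block_mx (sysA S1) 0 0 (sysA S2))
         (col_mx (sysB S1) (sysB S2))
         (row_mx (sysC S1) (sysC S2)).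

Definition big_parallel k (sz : 'I_k -> nat) m p
    (S : forall i, system F (sz i) m p) : system F (\sum_i sz i) m p :=
  System (\mxdiag_i sysA (S i)) (\mxcol_i sysB (S i)) (\mxrow_i sysC (S i)).

Definition jordan_block (a : F) n : 'M[F]_n :=
  \matrix_(i, j) (if j == i :> nat then a else if j == i.+1 :> nat then 1 else 0).

(* Feedback u = K y. *)
Definition closed_loop n q m p (P : system F n m p) (K : system F q p m) :
    'M[F]_(n + q) :=
  block_mx (sysA P) (sysB P *m sysC K) (sysB K *m sysC P) (sysA K).

End Systems.

Section TransferMatrices.
Variable R : realType.

Definition jw (w : R) : R[i] := Complex 0 w.

Definition complexify n m p (S : system R n m p) : system R[i] n m p :=
  System (map_mx (real_complex R) (sysA S)) (map_mx (real_complex R) (sysB S))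
         (map_mx (real_complex R) (sysC S)).

Definition hurwitz n (A : 'M[R]_n) : Prop :=
  forall a : R[i], eigenvalue (map_mx (real_complex R) A) a -> complex.Re a < 0.

Definition antistable n (A : 'M[R]_n) : Prop :=
  forall a : R[i], eigenvalue (map_mx (real_complex R) A) a -> 0 <= complex.Re a.

(* Rational transfer matrices, as matrices over the field C(s). They are not
   functions of s: the closed-loop matrices below are formed in C(s), so that
   cancellations at poles of G or K on the imaginary axis take place before
   evaluation. *)
Definition ratfun := {fraction {poly R[i]}}.
Definition tfm (p m : nat) := 'M[ratfun]_(p, m).

Definition cst_tfm p m (M : 'M[R[i]]_(p, m)) : tfm p m :=
  map_mx (fun c => tofrac (c%:P)) M.

(* C (sI - A)^-1 B; char_poly_mx A is 'X%:M - A. *)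
Definition transfer n m p (S : system R[i] n m p) : tfm p m :=
  cst_tfm (sysC S) *m invmx (map_mx (@tofrac _) (char_poly_mx (sysA S)))
    *m cst_tfm (sysB S).

(* The value at s, read off a coprime numerator/denominator pair; it is the
   junk value 0 when s is a pole. *)
Definition rateval (f : ratfun) (s : R[i]) : R[i] :=
  let N := (repr f).1 in let D := (repr f).2 in let g := gcdp N D in
  (N %/ g).[s] / (D %/ g).[s].

Definition tfm_at p m (F : tfm p m) (s : R[i]) : 'M[R[i]]_(p, m) :=
  map_mx (fun f => rateval f s) F.

Definition real_rational p m (F : tfm p m) : Prop :=
  forall i j, exists a b : {poly R}, b != 0 /\
    F i j = tofrac (map_poly (real_complex R) a)
            / tofrac (map_poly (real_complex R) b).

(* Largest singular value, i.e. largest nonnegative square root of an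
   eigenvalue of M^* M; it is 0 when M has no column. *)
Definition sigma_max p m (M : 'M[R[i]]_(p, m)) : R :=
  sup [set x : R | 0 <= x /\
    eigenvalue ((map_mx Num.conj M)^T *m M) (real_complex R (x ^+ 2))].

(* Both norms are only meant for transfer matrices without poles in the closed
   right half-plane (and strictly proper for h2norm). *)
Definition hinfnorm p m (F : tfm p m) : \bar R :=
  ereal_sup [set (sigma_max (tfm_at F (jw w)))%:E | w in [set: R]].

(* For real-rational F the trace is the real number Tr(F(jw)^* F(jw)). *)
Definition h2norm p m (F : tfm p m) : \bar R :=
  sqrte ((2 * pi)^-1%:E *
    \int[@lebesgue_measure R]_(w in [set: R])
      (complex.Re (\tr ((tfm_at F (- jw w))^T *m tfm_at F (jw w))))%:E)%E.

(* Y = (I - G K)^-1 and X = (I - G K)^-1 G, for the feedback u = K y. *)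
Definition Ytf p m (G : tfm p m) (K : tfm m p) : tfm p p :=
  invmx (1%:M - G *m K).
Definition Xtf p m (G : tfm p m) (K : tfm m p) : tfm p m := Ytf G K *m G.

(* Normalized LQG cost: with unit-spectrum white noises w, v, it is the limit
   of E[1/T int_0^T (x^T C^T C x + u^T u) dt], taken here through its expression
   as a sum of squared H2 norms. *)
Definition lqg_cost p m (G : tfm p m) (K : tfm m p) : \bar R :=
  (h2norm (Xtf G K) ^+ 2 + h2norm (Xtf G K *m K) ^+ 2 +
   h2norm (K *m Xtf G K) ^+ 2 + h2norm (K *m Ytf G K) ^+ 2)%E.

(* A controller given by its transfer matrix is represented by a real minimal
   realization; all of them are similar, so the choice is immaterial. *)
Definition internally_stabilizes n m p (P : system R n m p) (K : tfm m p) : Prop :=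
  exists (q : nat) (S : system R q p m),
    [/\ minimal S, transfer (complexify S) = K & hurwitz (closed_loop P S)].

Definition stable_unstable_separation n n1 n2 m p (K : system R n m p)
    (Klt : system R n1 m p) (Kge : system R n2 m p) : Prop :=
  [/\ similar K (parallel Klt Kge), hurwitz (sysA Klt) & antistable (sysA Kge)].

(* F is obtained from S by discarding r of the k > r (complex) Jordan blocks,
   those with the smallest H-infinity norms, ties being broken arbitrarily. *)
Definition modal_truncation n m p (r : nat) (S : system R n m p) (F : tfm p m) :
    Prop :=
  exists (k : nat) (sz : 'I_k -> nat) (a : 'I_k -> R[i])
         (blk : forall i, system R[i] (sz i) m p) (removed : {set 'I_k}),
  [/\ (forall i, (0 < sz i)%N /\ sysA (blk i) = jordan_block (a i) (sz i)),
      similar (complexify S) (big_parallel blk),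
      [/\ (0 < r)%N, (r < k)%N & #|removed| = r],
      (forall i j, i \in removed -> j \notin removed ->
         (hinfnorm (transfer (blk i)) <= hinfnorm (transfer (blk j)))%E)
    & F = \sum_(i | i \notin removed) transfer (blk i)].

End TransferMatrices.

(* Main.v *)
Require Import Defs.
From HB Require Import structures.
From mathcomp Require Import all_boot all_order all_algebra.
From mathcomp Require Import fraction generic_quotient.
From mathcomp Require Import all_classical all_reals all_analysis.
From mathcomp Require Import complex.
From mathcomp Require Import perm spectral measurable_realfun ring lra.

Set Implicit Arguments.
Unset Strict Implicit.
Unset Printing Implicit Defensive.

Import Order.TTheory GRing.Theory Num.Theory.
Import Normc numFieldNormedType.Exports.
Local Open Scope ring_scope.

(** Let [D] denote the truncation error [Delta], so that the reduced controller is
    [Kr = K - D], and let [X] and [Y] be as in the statement. Since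
    [1 - G Kr = (1 - G K) (1 + X D)], the perturbed loop is the nominal one
    followed by [W = (1 + X D)^-1]:
      [Yr = W Y], [Xr = W X], [Xr Kr = W (X K - X D)],
      [Kr Yr = K Y - (K X + 1) D W Y], [Kr Xr = K X - (K X + 1) D W X]
    (lemmas [perturbed_Y] to [perturbed_K]). Everything follows from these
    identities of matrices over [C(s)] and from two facts on [W].

    First, [W] has no pole in the closed right half-plane. As [|X D| < 1] on the
    imaginary axis, this is the small-gain theorem [small_gain], which reduces to
    the maximum modulus principle for a scalar rational function that is regular
    on the half-plane and decays at infinity ([halfplane_maximum_modulus]). The
    principle is obtained from compactness and from the local expansion of a
    rational function ([rational_no_local_max]).

    Secondly, [|W V|] and [|V W|] are at most [|V| / (1 - |X| |D|)] pointwise on the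
    axis, where vectors and matrices carry the Frobenius norm. This norm is
    submultiplicative against the largest singular value on either side
    ([fnorm_mul_sigma], from the spectral theorem, and [fnorm_sigma_mul]).
    Squaring and integrating the bounds, with Minkowski's inequality for the sums,
    gives the four H2 norms of the perturbed loop; the sum of their squares is the
    right-hand side ([lqg_cost_perturbed]).

    Internal stability is a statement on state-space matrices and has to be
    exchanged with stability of transfer matrices. In one direction, the four
    closed-loop transfer matrices are the blocks of the transfer matrix of one
    system whose state matrix is the closed-loop matrix ([transfer_feedback]). In
    the other, controllability and observability give polynomial Bezout identities,
    which feedback preserves and which express the resolvent through the transfer
    matrix ([bezout_resolvent_regular], [hurwitz_feedback]). The latter needs a
    minimal real realization of [Kr], which is only known as a sum of transfer
    matrices of complex Jordan blocks and of a real system: [real_realization]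
    takes real and imaginary parts of the state, and is correct because [Kr] is
    real rational; [minimal_realization] then removes uncontrollable and
    unobservable states. *)

(** * Values of rational functions at regular points *)

Section Values.
Variable R : realType.
Implicit Types (f g : ratfun R) (s v w : R[i]) (a b : {poly R[i]}).

(** Value of a fraction at a point that is not a pole. Unlike [rateval], which is
    total, it is compatible with the field operations and, through them, with
    products, determinants and inverses of matrices. *)
Definition has_value f s v : Prop := exists a b,
  [/\ b.[s] != 0, f = tofrac a / tofrac b & v = a.[s] / b.[s]].

Lemma tofrac_neq0_at b s : b.[s] != 0 -> tofrac b != 0.
Proof. by rewrite tofrac_eq0; apply: contraNneq => ->; rewrite horner0. Qed.

Lemma frac_eq a b a' b' : b != 0 -> b' != 0 ->
  (tofrac a / tofrac b = tofrac a' / tofrac b') <-> (a * b' = a' * b).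
Proof.
rewrite -(tofrac_eq0 b) -(tofrac_eq0 b') => b0 b0'; split=> [/eqP|e].
  by rewrite (eqr_div _ _ b0 b0') -!tofracM tofrac_eq => /eqP.
by apply/eqP; rewrite (eqr_div _ _ b0 b0') -!tofracM e.
Qed.

Lemma has_value_tofrac a s : has_value (tofrac a) s a.[s].
Proof. by exists a, 1; rewrite hornerC oner_eq0 tofrac1 !divr1. Qed.

Lemma has_value0 s : has_value 0 s 0.
Proof. by have := has_value_tofrac 0 s; rewrite tofrac0 horner0. Qed.

Lemma has_value1 s : has_value 1 s 1.
Proof. by have := has_value_tofrac 1 s; rewrite tofrac1 hornerC. Qed.

Lemma has_valueD f g s v w :
  has_value f s v -> has_value g s w -> has_value (f + g) s (v + w).
Proof.
move=> [a [b [bs -> ->]]] [a' [b' [bs' -> ->]]].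
exists (a * b' + a' * b), (b * b'); split; first by rewrite hornerM mulf_neq0.
  rewrite (addf_div _ _ (tofrac_neq0_at bs) (tofrac_neq0_at bs')).
  by rewrite tofracD !tofracM.
by rewrite hornerD !hornerM (addf_div _ _ bs bs').
Qed.

Lemma has_valueM f g s v w :
  has_value f s v -> has_value g s w -> has_value (f * g) s (v * w).
Proof.
move=> [a [b [bs -> ->]]] [a' [b' [bs' -> ->]]].
exists (a * a'), (b * b'); split; first by rewrite hornerM mulf_neq0.
  by rewrite !tofracM mulf_div.
by rewrite !hornerM mulf_div.
Qed.

Lemma has_valueV f s v : has_value f s v -> v != 0 -> has_value f^-1 s v^-1.
Proof.
move=> [a [b [bs -> ->]]]; rewrite mulf_eq0 invr_eq0 negb_or => /andP[as0 _].
by exists b, a; rewrite !invf_div.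
Qed.

Lemma horner_neq0 b s : b.[s] != 0 -> b != 0.
Proof. by apply: contraNneq => ->; rewrite horner0. Qed.

Lemma has_value_uniq f s v w : has_value f s v -> has_value f s w -> v = w.
Proof.
move=> [a [b [bs -> ->]]] [a' [b' [bs' e ->]]].
move/(frac_eq _ _ (horner_neq0 bs) (horner_neq0 bs')): e => e.
by apply/eqP; rewrite (eqr_div _ _ bs bs') -!hornerM e.
Qed.

Lemma has_valueN f s v : has_value f s v -> has_value (- f) s (- v).
Proof.
move=> fv; have := has_valueM (has_value_tofrac (-1) s) fv.
by rewrite tofracN tofrac1 hornerN hornerC !mulN1r.
Qed.

Lemma has_value_sum (I : Type) (r : seq I) (P : pred I) (F : I -> ratfun R)
    (V : I -> R[i]) s :
  (forall i, P i -> has_value (F i) s (V i)) ->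
  has_value (\sum_(i <- r | P i) F i) s (\sum_(i <- r | P i) V i).
Proof.
move=> FV; elim/big_ind2: _ => //; first exact: has_value0.
by move=> *; exact: has_valueD.
Qed.

Lemma has_value_prod (I : Type) (r : seq I) (P : pred I) (F : I -> ratfun R)
    (V : I -> R[i]) s :
  (forall i, P i -> has_value (F i) s (V i)) ->
  has_value (\prod_(i <- r | P i) F i) s (\prod_(i <- r | P i) V i).
Proof.
move=> FV; elim/big_ind2: _ => //; first exact: has_value1.
by move=> *; exact: has_valueM.
Qed.

(** The quotient that [rateval] reads off is in lowest terms, so its
    denominator divides that of any other representation. *)
Lemma lowest_terms f : exists a b, [/\ coprimep a b, f = tofrac a / tofrac b &
  b != 0 /\ forall s, rateval f s = a.[s] / b.[s]].
Proof.
have fE : f * tofrac (repr f).2 = tofrac (repr f).1.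
  rewrite -{1}[f]reprK; unlock tofrac; rewrite -[LHS]FracField.pi_mul.
  apply/eqmodP; rewrite /FracField.mulf /= /FracField.equivf.
  by rewrite !numden_Ratio ?oner_eq0 ?denom_ratioP ?mulr1 1?mulrC ?denom_ratioP.
rewrite /rateval; set N := (repr f).1 in fE *; set D := (repr f).2 in fE *.
set g := gcdp N D.
have D0 : D != 0 by exact: denom_ratioP.
have g0 : g != 0 by rewrite gcdp_eq0 negb_and D0 orbT.
have {}fE : f = tofrac N / tofrac D.
  by rewrite -fE mulfK; [|rewrite tofrac_eq0].
have Dg : g %| D by exact: dvdp_gcdr.
have Ng : g %| N by exact: dvdp_gcdl.
exists (N %/ g), (D %/ g); split.
- by apply: coprimep_div_gcd; rewrite D0 orbT.
- rewrite {1}fE; apply/(frac_eq _ _ D0); first by rewrite dvdp_div_eq0.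
  by rewrite -{1}(divpK Ng) -{2}(divpK Dg) mulrAC mulrA.
- by split; first by rewrite dvdp_div_eq0.
Qed.

Lemma lowest_terms_dvd a b a' b' : coprimep a b -> b != 0 -> b' != 0 ->
  tofrac a / tofrac b = tofrac a' / tofrac b' -> a * b' = a' * b /\ b %| b'.
Proof.
move=> cab b0 b0' /(frac_eq _ _ b0 b0') e.
split=> //; rewrite -(@Gauss_dvdpr _ _ a); last by rewrite coprimep_sym.
by rewrite e dvdp_mulIr.
Qed.

Lemma rateval_has_value f s v : has_value f s v -> rateval f s = v.
Proof.
move=> [a [b [bs fE ->]]]; have [a' [b' [cab fE' [b0' ->]]]] := lowest_terms f.
have b0 : b != 0 by apply: contraNneq bs => ->; rewrite horner0.
have [e /dvdpP[c bE]] := lowest_terms_dvd cab b0' b0 (etrans (esym fE') fE).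
have bs' : b'.[s] != 0.
  by move: bs; rewrite bE hornerM mulf_eq0 negb_or => /andP[].
by apply/eqP; rewrite (eqr_div _ _ bs' bs) -!hornerM e.
Qed.

(** The lowest-terms pair serves all points at once. *)
Lemma regular_represented f (D : R[i] -> Prop) :
  (forall s, D s -> exists v, has_value f s v) ->
  exists a b, [/\ forall s, D s -> b.[s] != 0 & f = tofrac a / tofrac b].
Proof.
move=> fD; have [a [b [cab fE [b0 _]]]] := lowest_terms f; exists a, b; split=> //.
move=> s /fD[v [a' [b' [bs' fE' _]]]].
have b0' : b' != 0 by apply: contraNneq bs' => ->; rewrite horner0.
have [_ /dvdpP[c bE]] := lowest_terms_dvd cab b0 b0' (etrans (esym fE) fE').
by apply: contraNneq bs' => bs; rewrite bE hornerM bs mulr0.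
Qed.

Local Notation toC := (real_complex R).

Lemma map_conjc_real (a : {poly R}) :
  map_poly conjc (map_poly toC a) = map_poly toC a.
Proof. by apply/polyP => k; rewrite !coef_map; exact: conjc_real. Qed.

(** Conjugating the coefficients of a pair that represents [f] yields another pair
    for [f], because [f] is also a quotient of real polynomials. *)
Lemma has_value_conj f s v (a b : {poly R}) : b != 0 ->
  f = tofrac (map_poly toC a) / tofrac (map_poly toC b) ->
  has_value f s v -> has_value f (conjc s) (conjc v).
Proof.
move=> b0 fE [a' [b' [bs' fE' ->]]].
have bs0 : b' != 0 by apply: contraNneq bs' => ->; rewrite horner0.
have mb0 : map_poly toC b != 0 by rewrite map_poly_eq0.
exists (map_poly conjc a'), (map_poly conjc b'); split.
- by rewrite horner_map /= conjc_eq0.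
- move: fE'; rewrite fE => /(frac_eq _ _ mb0 bs0)/(congr1 (map_poly conjc)).
  rewrite !rmorphM /= !map_conjc_real => e.
  by apply/(frac_eq _ _ mb0); first by rewrite map_poly_eq0.
- by rewrite !horner_map rmorphM /= conjc_inv.
Qed.

Definition has_values p m (F : tfm R p m) s (V : 'M[R[i]]_(p, m)) : Prop :=
  forall i j, has_value (F i j) s (V i j).

Definition regular p m (F : tfm R p m) s : Prop := exists V, has_values F s V.

Lemma tfm_at_has_values p m (F : tfm R p m) s V : has_values F s V -> tfm_at F s = V.
Proof.
by move=> FV; apply/matrixP => i j; rewrite mxE (rateval_has_value (FV i j)).
Qed.

Lemma regular_has_values p m (F : tfm R p m) s :
  regular F s -> has_values F s (tfm_at F s).
Proof. by move=> [V FV]; rewrite (tfm_at_has_values FV). Qed.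

Lemma regularP p m (F : tfm R p m) s :
  regular F s <-> forall i j, exists v, has_value (F i j) s v.
Proof.
split=> [[V FV] i j|/(_ _ _)/cid FV]; first by exists (V i j).
by exists (\matrix_(i, j) sval (FV i j)) => i j; rewrite mxE; case: FV.
Qed.

Lemma has_valuesD p m (F G : tfm R p m) s V W :
  has_values F s V -> has_values G s W -> has_values (F + G) s (V + W).
Proof. by move=> FV GW i j; rewrite !mxE; exact: has_valueD. Qed.

Lemma has_valuesN p m (F : tfm R p m) s V :
  has_values F s V -> has_values (- F) s (- V).
Proof. by move=> FV i j; rewrite !mxE; exact: has_valueN. Qed.

Lemma has_valuesB p m (F G : tfm R p m) s V W :
  has_values F s V -> has_values G s W -> has_values (F - G) s (V - W).
Proof. by move=> FV /has_valuesN; exact: has_valuesD. Qed.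

Lemma has_valuesM p m q (F : tfm R p m) (G : tfm R m q) s V W :
  has_values F s V -> has_values G s W -> has_values (F *m G) s (V *m W).
Proof.
by move=> FV GW i j; rewrite !mxE; apply: has_value_sum => k _; exact: has_valueM.
Qed.

Lemma has_values_poly p m (A : 'M[{poly R[i]}]_(p, m)) s :
  has_values (map_mx (@tofrac _) A) s (map_mx (horner^~ s) A).
Proof. by move=> i j; rewrite !mxE; exact: has_value_tofrac. Qed.

Lemma has_values_cst p m (M : 'M[R[i]]_(p, m)) s : has_values (cst_tfm M) s M.
Proof.
by move=> i j; rewrite mxE -[X in has_value _ _ X](hornerC (M i j) s);
  exact: has_value_tofrac.
Qed.

Lemma has_values1 n s : has_values (1%:M : tfm R n n) s 1%:M.
Proof.
by move=> i j; rewrite !mxE; case: (i == j); [exact: has_value1|exact: has_value0].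
Qed.

Lemma has_value_det n (F : tfm R n n) s V :
  has_values F s V -> has_value (\det F) s (\det V).
Proof.
move=> FV; apply: has_value_sum => t _; apply: has_valueM.
  by case: (odd_perm t); [apply: has_valueN|]; exact: has_value1.
by apply: has_value_prod => i _.
Qed.

(** Cramer: the inverse is the adjugate divided by a determinant that does not
    vanish at the point. *)
Lemma has_values_inv n (F : tfm R n n) s V : has_values F s V ->
  V \in unitmx -> F \in unitmx /\ has_values (invmx F) s (invmx V).
Proof.
move=> FV uV; have dV : \det V != 0 by rewrite -unitfE -unitmxE.
have dFV := has_value_det FV.
have uF : F \in unitmx.
  rewrite unitmxE unitfE; apply: contraNneq dV => dF0.
  by rewrite dF0 in dFV; apply/eqP/(has_value_uniq dFV)/has_value0.
split; first exact: uF.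
rewrite /invmx uF uV => i j; rewrite !mxE.
apply: has_valueM; first exact (has_valueV dFV dV).
rewrite /cofactor; apply: has_valueM; last first.
  by apply: has_value_det => k l; rewrite !mxE; exact: FV.
elim: (j + i)%N => [|k IHk]; first by rewrite !expr0; exact: has_value1.
by rewrite !exprS; apply: (has_valueM _ IHk); apply: has_valueN; exact: has_value1.
Qed.

End Values.

(** * Transfer matrices of interconnected systems *)

Section Resolvents.
Variable R : realType.
Local Notation C := R[i].

Lemma cst_tfmE p m (M : 'M[C]_(p, m)) :
  cst_tfm M = map_mx (@tofrac _) (map_mx polyC M).
Proof. by apply/matrixP => i j; rewrite !mxE. Qed.

Lemma cst_tfmM p m q (M : 'M[C]_(p, m)) (N : 'M[C]_(m, q)) :
  cst_tfm (M *m N) = cst_tfm M *m cst_tfm N.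
Proof. by rewrite !cst_tfmE !map_mxM. Qed.

Lemma cst_tfmD p m (M N : 'M[C]_(p, m)) :
  cst_tfm (M + N) = cst_tfm M + cst_tfm N.
Proof. by rewrite !cst_tfmE !map_mxD. Qed.

Lemma cst_tfm0 p m : cst_tfm (0 : 'M[C]_(p, m)) = 0.
Proof. by rewrite cst_tfmE !map_mx0. Qed.

Lemma cst_tfm_block p1 p2 m1 m2 (M1 : 'M[C]_(p1, m1)) M2 M3 (M4 : 'M[C]_(p2, m2)) :
  cst_tfm (block_mx M1 M2 M3 M4) =
  block_mx (cst_tfm M1) (cst_tfm M2) (cst_tfm M3) (cst_tfm M4).
Proof. by rewrite !cst_tfmE !map_block_mx. Qed.

Definition pencil n (A : 'M[C]_n) : tfm R n n := map_mx (@tofrac _) (char_poly_mx A).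

Definition resolvent n (A : 'M[C]_n) : tfm R n n := invmx (pencil A).

Lemma pencilE n (A : 'M[C]_n) : pencil A = (tofrac 'X)%:M - cst_tfm A.
Proof. by rewrite /pencil /char_poly_mx map_mxB map_scalar_mx cst_tfmE. Qed.

Lemma pencil_unit n (A : 'M[C]_n) : pencil A \in unitmx.
Proof.
by rewrite unitmxE unitfE det_map_mx tofrac_eq0 -size_poly_eq0 size_char_poly.
Qed.

Lemma mul_resolvent n (A : 'M[C]_n) : resolvent A *m pencil A = 1%:M.
Proof. by rewrite mulVmx // pencil_unit. Qed.

Lemma mul_pencil n (A : 'M[C]_n) : pencil A *m resolvent A = 1%:M.
Proof. by rewrite mulmxV // pencil_unit. Qed.

Lemma resolvent_unique n (A : 'M[C]_n) Phi : pencil A *m Phi = 1%:M ->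
  resolvent A = Phi.
Proof. by move=> e; rewrite -[LHS]mulmx1 -e mulmxA mul_resolvent mul1mx. Qed.

(** All identities between transfer matrices of different realizations come from
    intertwinings of the state matrices by a constant rectangular matrix. *)
Lemma resolvent_intertwine n k (A : 'M[C]_n) (A' : 'M[C]_k) (T : 'M[C]_(n, k)) :
  A *m T = T *m A' -> resolvent A *m cst_tfm T = cst_tfm T *m resolvent A'.
Proof.
move=> e; have eT : pencil A *m cst_tfm T = cst_tfm T *m pencil A'.
  rewrite !pencilE mulmxBl mulmxBr -!cst_tfmM e.
  by rewrite mul_scalar_mx mul_mx_scalar.
rewrite -[LHS]mulmx1 -(mul_pencil A') !mulmxA -[_ *m _ *m pencil A']mulmxA -eT.
by rewrite mulmxA mul_resolvent mul1mx.
Qed.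

Lemma transferE n m p (S : system C n m p) :
  transfer S = cst_tfm (sysC S) *m resolvent (sysA S) *m cst_tfm (sysB S).
Proof. exact (erefl _). Qed.

Lemma transfer_intertwine n n' m p (S : system C n m p) (S' : system C n' m p)
    (T : 'M[C]_(n, n')) :
  sysA S *m T = T *m sysA S' -> T *m sysB S' = sysB S -> sysC S *m T = sysC S' ->
  transfer S = transfer S'.
Proof.
move=> eA eB eC; rewrite !transferE -eB -eC !cst_tfmM !mulmxA.
by rewrite -[in LHS](mulmxA (cst_tfm (sysC S))) (resolvent_intertwine eA) !mulmxA.
Qed.

Lemma transfer_similar n n' m p (S : system C n m p) (S' : system C n' m p) :
  Defs.similar S S' -> transfer S = transfer S'.
Proof.
move=> [T [Ti [e1 e2 eS]]]; apply/esym/(@transfer_intertwine _ _ _ _ _ _ T).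
- by rewrite -eS /= -!mulmxA e2 mulmx1.
- by rewrite -eS.
- by rewrite -eS /= -!mulmxA e2 mulmx1.
Qed.

Lemma pencil_block n1 n2 (A1 : 'M[C]_n1) (A2 : 'M[C]_n2) U V :
  pencil (block_mx A1 U V A2) =
  block_mx (pencil A1) (- cst_tfm U) (- cst_tfm V) (pencil A2).
Proof.
by rewrite !pencilE cst_tfm_block scalar_mx_block opp_block_mx add_block_mx !add0r.
Qed.

Lemma transfer_parallel n1 n2 m p (S1 : system C n1 m p) (S2 : system C n2 m p) :
  transfer (parallel S1 S2) = transfer S1 + transfer S2.
Proof.
rewrite !transferE /=.
have -> : resolvent (block_mx (sysA S1) 0 0 (sysA S2)) =
    block_mx (resolvent (sysA S1)) 0 0 (resolvent (sysA S2)).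
  apply: resolvent_unique; rewrite pencil_block !cst_tfm0 !oppr0 mulmx_block.
  by rewrite !mul_pencil !(mulmx0, mul0mx, addr0, add0r) -scalar_mx_block.
rewrite !cst_tfmE map_row_mx map_row_mx map_col_mx map_col_mx.
by rewrite mul_row_block !mulmx0 addr0 add0r mul_row_col.
Qed.

Lemma cst_tfm_mxdiag k (sz : 'I_k -> nat) (A : forall i, 'M[C]_(sz i)) :
  cst_tfm (\mxdiag_i A i) = \mxdiag_i cst_tfm (A i).
Proof.
apply/matrixP => a b; rewrite !mxE; case: ifP => _; last by rewrite !mxE tofrac0.
rewrite !cst_tfmE -(map_mx0 (@tofrac _)) -(map_mx0 polyC) -!map_conform_mx.
by rewrite !mxE.
Qed.


Lemma transfer_big_parallel k (sz : 'I_k -> nat) m p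
    (S : forall i, system C (sz i) m p) :
  transfer (big_parallel S) = \sum_i transfer (S i).
Proof.
rewrite transferE /=.
have -> : resolvent (\mxdiag_i sysA (S i)) = \mxdiag_i resolvent (sysA (S i)).
  apply: resolvent_unique; rewrite pencilE cst_tfm_mxdiag -!mxdiagZ -mxdiagB.
  rewrite mul_mxdiag_mxblock; apply: eq_mxblock => i j.
  case: eqP => [<-|_]; last by rewrite mulmx0.
  by rewrite !conform_mx_id -pencilE mul_pencil.
have -> : cst_tfm (\mxcol_i sysB (S i)) = \mxcol_i cst_tfm (sysB (S i)).
  by apply/matrixP => a b; rewrite !mxE.
have -> : cst_tfm (\mxrow_i sysC (S i)) = \mxrow_i cst_tfm (sysC (S i)).
  by apply/matrixP => a b; rewrite !mxE.
by rewrite mul_mxrow_mxdiag mul_mxrow_mxcol.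
Qed.

End Resolvents.

(** * The closed-loop transfer matrix *)

Section ClosedLoop.
Variable R : realType.
Local Notation C := R[i].
Local Notation toC := (real_complex R).

Definition stable_mx n (A : 'M[C]_n) : Prop :=
  forall s, 0 <= complex.Re s -> ~~ root (char_poly A) s.

Lemma hurwitzP n (A : 'M[R]_n) : hurwitz A <-> stable_mx (map_mx toC A).
Proof.
split=> [hA s s0|sA a]; rewrite ?eigenvalue_root_char.
  apply/negP => As; suff : complex.Re s < 0 by rewrite ltNge s0.
  by apply: hA; rewrite eigenvalue_root_char.
by rewrite ltNge => Aa; apply/negP => /sA; rewrite Aa.
Qed.

Lemma has_values_pencil n (A : 'M[C]_n) s :
  has_values (pencil A) s (map_mx (horner_eval s) (char_poly_mx A)).
Proof. exact: has_values_poly. Qed.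

Lemma regular_resolvent n (A : 'M[C]_n) s :
  ~~ root (char_poly A) s -> regular (resolvent A) s.
Proof.
move=> As; have [|_ rV] := has_values_inv (has_values_pencil A s).
  by rewrite unitmxE det_map_mx unitfE.
by exists (invmx (map_mx (horner_eval s) (char_poly_mx A))).
Qed.

(** The value of the resolvent inverts that of the pencil, whose determinant is
    the characteristic polynomial. *)
Lemma resolvent_regular n (A : 'M[C]_n) s :
  regular (resolvent A) s -> ~~ root (char_poly A) s.
Proof.
move=> [V rV]; have := has_valuesM (has_values_pencil A s) rV.
rewrite mul_pencil => e; apply/negP => /rootP A0.
have /esym := has_value_uniq (has_value_det (@has_values1 _ n s)) (has_value_det e).
rewrite det_mulmx det_map_mx det1 [X in X * _]A0 mul0r => /eqP.
by rewrite eq_sym oner_eq0.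
Qed.

Lemma regularM p m q (F : tfm R p m) (G : tfm R m q) s :
  regular F s -> regular G s -> regular (F *m G) s.
Proof. by move=> [V FV] [W GW]; exists (V *m W); exact: has_valuesM. Qed.

Lemma regularD p m (F G : tfm R p m) s :
  regular F s -> regular G s -> regular (F + G) s.
Proof. by move=> [V FV] [W GW]; exists (V + W); exact: has_valuesD. Qed.

Lemma regularB p m (F G : tfm R p m) s :
  regular F s -> regular G s -> regular (F - G) s.
Proof. by move=> [V FV] [W GW]; exists (V - W); exact: has_valuesB. Qed.

Lemma regular_cst p m (M : 'M[C]_(p, m)) s : regular (cst_tfm M) s.
Proof. by exists M; exact: has_values_cst. Qed.

Lemma regular_transfer n m p (S : system C n m p) s :
  ~~ root (char_poly (sysA S)) s -> regular (transfer S) s.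
Proof.
by move=> As; rewrite transferE; apply: regularM (regular_cst _ s);
  apply: regularM (regular_resolvent As); exact: regular_cst.
Qed.

Lemma regular_block p1 p2 m1 m2 (F : tfm R p1 m1) G H (K : tfm R p2 m2) s :
  regular (block_mx F G H K) s <->
  [/\ regular F s, regular G s, regular H s & regular K s].
Proof.
split=> [[V]|[[VF hF] [VG hG] [VH hH] [VK hK]]].
  rewrite -[V]submxK => hV; split.
  - by exists (ulsubmx V) => i j; have := hV (lshift _ i) (lshift _ j);
      rewrite !block_mxEul.
  - by exists (ursubmx V) => i j; have := hV (lshift _ i) (rshift _ j);
      rewrite !block_mxEur.
  - by exists (dlsubmx V) => i j; have := hV (rshift _ i) (lshift _ j);
      rewrite !block_mxEdl.
  - by exists (drsubmx V) => i j; have := hV (rshift _ i) (rshift _ j);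
      rewrite !block_mxEdr.
exists (block_mx VF VG VH VK) => i j.
by case: (split_ordP i) => k ->; case: (split_ordP j) => l ->;
  rewrite ?(block_mxEul, block_mxEur, block_mxEdl, block_mxEdr).
Qed.

(** The closed loop driven by [w] and [v] and observed through [y - v] and [u]. *)
Definition feedback (F : fieldType) n q m p (P : system F n m p)
    (K : system F q p m) : system F (n + q) (m + p) (p + m) :=
  System (closed_loop P K) (block_mx (sysB P) 0 0 (sysB K))
         (block_mx (sysC P) 0 0 (sysC K)).

Lemma complexify_feedback n q m p (P : system R n m p) (K : system R q p m) :
  complexify (feedback P K) = feedback (complexify P) (complexify K).
Proof. by congr System; rewrite /= map_block_mx ?map_mxM ?map_mx0. Qed.

(** Read block by block, [(s - A_cl) Phi = 1] says that the closed-loop transfer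
    matrix [h] satisfies [h11 = G + G h21], [h21 = K h11], [h12 = G h22] and
    [h22 = K + K h12]. Eliminating the second row leaves [(1 - G K) h11 = G] and
    [(1 - G K) (1 + h12) = 1]; the latter also shows that the loop is well posed. *)
Lemma transfer_feedback n q m p (P : system C n m p) (K : system C q p m) :
  let G := transfer P in let KK := transfer K in
  1%:M - G *m KK \in unitmx /\ transfer (feedback P K) =
    block_mx (Xtf G KK) (Xtf G KK *m KK) (KK *m Xtf G KK) (KK *m Ytf G KK).
Proof.
move=> G KK.
set b := cst_tfm (sysB P); set c := cst_tfm (sysC P).
set bK := cst_tfm (sysB K); set cK := cst_tfm (sysC K).
set Phi := resolvent (closed_loop P K).
have := mul_pencil (closed_loop P K); rewrite -/Phi -[Phi]submxK.
set f11 := ulsubmx Phi; set f12 := ursubmx Phi.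
set f21 := dlsubmx Phi; set f22 := drsubmx Phi.
rewrite /closed_loop pencil_block mulmx_block scalar_mx_block !cst_tfmM.
rewrite -/b -/c -/bK -/cK => /eq_block_mx[e11 e12 e21 e22].
have solve k l l' (A : 'M[C]_k) (U : tfm R k l) (V : tfm R l' l) W :
    pencil A *m U + - W *m V = 0 -> U = resolvent A *m (W *m V).
  move=> /eqP; rewrite mulNmx subr_eq0 => /eqP <-.
  by rewrite mulmxA mul_resolvent mul1mx.
have {}e12 := solve _ _ _ _ _ _ _ e12.
have {}e21 : f21 = resolvent (sysA K) *m (bK *m c *m f11).
  by apply: solve; rewrite addrC.
have {}e11 : f11 = resolvent (sysA P) *m (1%:M + b *m cK *m f21).
  by rewrite -e11 mulNmx subrK mulmxA mul_resolvent mul1mx.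
have {}e22 : f22 = resolvent (sysA K) *m (1%:M + bK *m c *m f12).
  by rewrite -e22 mulNmx addrAC addNr add0r mulmxA mul_resolvent mul1mx.
have tE : transfer (feedback P K) = block_mx (c *m f11 *m b) (c *m f12 *m bK)
    (cK *m f21 *m b) (cK *m f22 *m bK).
  rewrite transferE /= !cst_tfm_block !cst_tfm0 -/b -/c -/bK -/cK -/Phi.
  rewrite -[Phi]submxK -/f11 -/f12 -/f21 -/f22 !mulmx_block.
  by rewrite !(mulmx0, mul0mx, addr0, add0r).
have GE : G = c *m resolvent (sysA P) *m b by exact (erefl _).
have KE : KK = cK *m resolvent (sysA K) *m bK by exact (erefl _).
set h11 := c *m f11 *m b; set h12 := c *m f12 *m bK.
set h21 := cK *m f21 *m b; set h22 := cK *m f22 *m bK.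
have h21E : h21 = KK *m h11 by rewrite /h21 e21 KE /h11 !mulmxA.
have h12E : h12 = G *m h22 by rewrite /h12 e12 GE /h22 !mulmxA.
have h11E : h11 = G + G *m h21.
  by rewrite /h11 e11 GE /h21 mulmxDr mulmx1 mulmxDr mulmxDl !mulmxA.
have h22E : h22 = KK + KK *m h12.
  by rewrite /h22 e22 KE /h12 mulmxDr mulmx1 mulmxDr mulmxDl !mulmxA.
have inv : (1%:M - G *m KK) *m (1%:M + h12) = 1%:M.
  rewrite mulmxDr mulmx1 mulmxBl mul1mx {1}h12E h22E mulmxDr !mulmxA.
  by rewrite addrK subrK.
have [uGK _] := mulmx1_unit inv; split=> //.
have YE : Ytf G KK = 1%:M + h12.
  by rewrite -[RHS](mulKmx uGK) inv mulmx1.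
have XE : Xtf G KK = h11.
  rewrite /Xtf /Ytf -[RHS](mulKmx uGK); congr (_ *m _).
  by rewrite mulmxBl mul1mx -mulmxA -h21E [in RHS]h11E addrK.
rewrite tE -/h11 -/h12 -/h21 -/h22 h22E XE YE -h21E mulmxDr mulmx1.
congr block_mx; rewrite -XE /Xtf -mulmxA -[h12](mulKmx uGK).
congr (_ *m _); rewrite mulmxBl mul1mx {1}h12E h22E mulmxDr !mulmxA.
by rewrite addrK.
Qed.

End ClosedLoop.

(** * Minimal systems: the poles are the eigenvalues *)

Section Bezout.
Variable F : fieldType.

Lemma controllable_right_inverse n m (A : 'M[F]_n) (B : 'M[F]_(n, m)) :
  controllable A B ->
  exists M : 'I_n -> 'M[F]_(m, n), \sum_(j < n) (A ^+ j *m B *m M j) = 1%:M.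
Proof.
move=> /eqP /row_freeP[M e]; exists (fun j => submxcol M j).
by rewrite -mul_mxrow_mxcol submxcolK.
Qed.

Lemma observable_tr n p (C : 'M[F]_(p, n)) (A : 'M[F]_n) :
  observable C A -> controllable A^T C^T.
Proof.
rewrite /observable /controllable -mxrank_tr tr_mxcol => rO.
rewrite -[RHS]rO; congr (\rank _).
apply: eq_mxrow => j; rewrite trmx_mul; congr (_ *m _).
elim: (j : nat) => [|k IHk]; first by rewrite !expr0 trmx1.
by rewrite exprS exprSr [RHS]trmx_mul -IHk.
Qed.

(** As [s^j - A^j] is a left multiple of [s - A], the right inverse
    [sum_j A^j B M_j = 1] turns into [B (sum_j s^j M_j) = 1] modulo [s - A]. *)
Lemma controllable_bezout n m (A : 'M[F]_n) (B : 'M[F]_(n, m)) :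
  controllable A B ->
  exists U V, char_poly_mx A *m U + map_mx polyC B *m V = 1%:M.
Proof.
move=> /controllable_right_inverse[M e]; set a := map_mx polyC A.
(* [Q j] is the quotient of [s^j - A^j] by [s - A]. *)
pose Q j : 'M[{poly F}]_n := \sum_(i < j) 'X%:M ^+ (j.-1 - i) * a ^+ i.
have QE j : char_poly_mx A *m Q j = 'X^j%:M - map_mx polyC (A ^+ j).
  have cA : GRing.comm ('X%:M : 'M[{poly F}]_n) a by exact: (esym (scalar_mxC 'X a)).
  rewrite /Q; have -> : 'X^j%:M = ('X%:M : 'M[{poly F}]_n) ^+ j.
    elim: j => [|j IHj]; first by rewrite !expr0.
    by rewrite !exprS scalar_mxM IHj.
  have -> : map_mx polyC (A ^+ j) = a ^+ j.
    elim: j => [|j IHj]; first by rewrite !expr0 map_mx1.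
    by rewrite !exprS -IHj map_mxM.
  by rewrite (subrXX_comm _ cA).
exists (- (\sum_(j < n) Q j *m map_mx polyC (B *m M j))),
  (\sum_(j < n) 'X^j *: map_mx polyC (M j)).
have := congr1 (map_mx polyC) e; rewrite map_mx1 raddf_sum /= => <-.
rewrite mulmxN !mulmx_sumr -sumrN -big_split; apply: eq_bigr => j _ /=.
rewrite mulmxA QE mulmxBl opprB mul_scalar_mx -scalemxAr -!map_mxM subrK.
by rewrite mulmxA.
Qed.

End Bezout.

Section Minimality.
Variable R : realType.
Local Notation C := R[i].
Local Notation toC := (real_complex R).

(** A right inverse of [(s - A, B)] without poles, such as a polynomial one. *)
Definition right_bezout n m (A : 'M[C]_n) (B : 'M[C]_(n, m)) : Prop :=
  exists U V, [/\ forall s, regular U s, forall s, regular V s &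
    pencil A *m U + cst_tfm B *m V = 1%:M].

Definition left_bezout n p (A : 'M[C]_n) (D : 'M[C]_(p, n)) : Prop :=
  exists U V, [/\ forall s, regular U s, forall s, regular V s &
    U *m pencil A + V *m cst_tfm D = 1%:M].

Lemma map_polyC_mx n m (B : 'M[R]_(n, m)) :
  map_mx (map_poly toC) (map_mx polyC B) = map_mx polyC (map_mx toC B).
Proof. by apply/matrixP => i j; rewrite !mxE map_polyC. Qed.

Lemma right_bezout_controllable n m (A : 'M[R]_n) (B : 'M[R]_(n, m)) :
  controllable A B -> right_bezout (map_mx toC A) (map_mx toC B).
Proof.
move=> /controllable_bezout[U [V e]].
exists (map_mx (@tofrac _) (map_mx (map_poly toC) U)).
exists (map_mx (@tofrac _) (map_mx (map_poly toC) V)).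
split; [by move=> s; eexists; exact: has_values_poly..|].
rewrite cst_tfmE /pencil -map_char_poly_mx -map_polyC_mx -!map_mxM -!map_mxD e.
by rewrite !map_mx1.
Qed.

Lemma cst_tfm_tr n m (B : 'M[C]_(n, m)) : cst_tfm B^T = (cst_tfm B)^T.
Proof. by rewrite !cst_tfmE !map_trmx. Qed.

Lemma pencil_tr n (A : 'M[C]_n) : pencil A^T = (pencil A)^T.
Proof. by rewrite !pencilE cst_tfm_tr linearB /= tr_scalar_mx. Qed.

Lemma left_bezout_observable n p (A : 'M[R]_n) (D : 'M[R]_(p, n)) :
  observable D A -> left_bezout (map_mx toC A) (map_mx toC D).
Proof.
move=> /observable_tr/right_bezout_controllable[U [V [rU rV e]]].
have rT k l (F : tfm R k l) : (forall s, regular F s) -> forall s, regular F^T s.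
  by move=> rF s; have [W FW] := rF s; exists W^T => i j; rewrite !mxE.
exists U^T, V^T; split; [exact: rT|exact: rT|].
have := congr1 trmx e; rewrite trmx1 linearD /= !trmx_mul.
by rewrite -!map_trmx pencil_tr cst_tfm_tr !trmxK.
Qed.

(** The term [B J D U] by which the pencil changes is a multiple of [B] and is
    absorbed by [V]: output feedback creates no uncontrollable mode. *)
Lemma right_bezout_feedback n m p (A : 'M[C]_n) (B : 'M[C]_(n, m)) J
    (D : 'M[C]_(p, n)) :
  right_bezout A B -> right_bezout (A + B *m J *m D) B.
Proof.
move=> [U [V [rU rV e]]]; exists U, (V + cst_tfm (J *m D) *m U); split=> //.
  by move=> s; apply: regularD => //; apply: regularM => //; exact: regular_cst.
have -> : pencil (A + B *m J *m D) = pencil A - cst_tfm B *m cst_tfm (J *m D).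
  by rewrite !pencilE cst_tfmD opprD addrA -cst_tfmM ?mulmxA.
by rewrite -e mulmxBl mulmxDr ?mulmxA [_ *m V + _]addrC addrA subrK.
Qed.

Lemma left_bezout_feedback n m p (A : 'M[C]_n) (B : 'M[C]_(n, m)) J
    (D : 'M[C]_(p, n)) :
  left_bezout A D -> left_bezout (A + B *m J *m D) D.
Proof.
move=> [U [V [rU rV e]]]; exists U, (V + U *m cst_tfm (B *m J)); split=> //.
  by move=> s; apply: regularD => //; apply: regularM => //; exact: regular_cst.
have -> : pencil (A + B *m J *m D) = pencil A - cst_tfm (B *m J) *m cst_tfm D.
  by rewrite !pencilE cst_tfmD opprD addrA -cst_tfmM ?mulmxA.
by rewrite -e mulmxBr mulmxDl cst_tfmM !mulmxA [V *m _ + _]addrC addrA subrK.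
Qed.

Lemma regular0 p m s : regular (0 : tfm R p m) s.
Proof. by rewrite -(cst_tfm0 R); exact: regular_cst. Qed.

Lemma right_bezout_diag n1 n2 m1 m2 (A1 : 'M[C]_n1) (A2 : 'M[C]_n2)
    (B1 : 'M[C]_(n1, m1)) (B2 : 'M[C]_(n2, m2)) :
  right_bezout A1 B1 -> right_bezout A2 B2 ->
  right_bezout (block_mx A1 0 0 A2) (block_mx B1 0 0 B2).
Proof.
move=> [U1 [V1 [rU1 rV1 e1]]] [U2 [V2 [rU2 rV2 e2]]].
exists (block_mx U1 0 0 U2), (block_mx V1 0 0 V2); split.
- by move=> s; apply/regular_block; split=> //; exact: regular0.
- by move=> s; apply/regular_block; split=> //; exact: regular0.
rewrite pencil_block cst_tfm_block !cst_tfm0 !oppr0 !mulmx_block.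
rewrite !(mulmx0, mul0mx, addr0, add0r) add_block_mx e1 e2 !addr0.
by rewrite -scalar_mx_block.
Qed.

Lemma left_bezout_diag n1 n2 p1 p2 (A1 : 'M[C]_n1) (A2 : 'M[C]_n2)
    (D1 : 'M[C]_(p1, n1)) (D2 : 'M[C]_(p2, n2)) :
  left_bezout A1 D1 -> left_bezout A2 D2 ->
  left_bezout (block_mx A1 0 0 A2) (block_mx D1 0 0 D2).
Proof.
move=> [U1 [V1 [rU1 rV1 e1]]] [U2 [V2 [rU2 rV2 e2]]].
exists (block_mx U1 0 0 U2), (block_mx V1 0 0 V2); split.
- by move=> s; apply/regular_block; split=> //; exact: regular0.
- by move=> s; apply/regular_block; split=> //; exact: regular0.
rewrite pencil_block cst_tfm_block !cst_tfm0 !oppr0 !mulmx_block.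
rewrite !(mulmx0, mul0mx, addr0, add0r) add_block_mx e1 e2 !addr0.
by rewrite -scalar_mx_block.
Qed.

(** With [U (s - A) + V D = 1] and [(s - A) U' + B V' = 1] the resolvent equals
    [U + V D U' + V (D (s - A)^-1 B) V']: it has no pole that the transfer matrix
    does not have. *)
Lemma bezout_resolvent_regular n m p (S : system C n m p) s :
  right_bezout (sysA S) (sysB S) -> left_bezout (sysA S) (sysC S) ->
  regular (transfer S) s -> ~~ root (char_poly (sysA S)) s.
Proof.
move=> [U' [V' [rU' rV' e']]] [U [V [rU rV e]]] rS; apply: resolvent_regular.
set Phi := resolvent (sysA S).
have PhiB : cst_tfm (sysC S) *m Phi = cst_tfm (sysC S) *m U' + transfer S *m V'.
  rewrite transferE -/Phi -!mulmxA -mulmxDr; congr (_ *m _).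
  by rewrite -[LHS]mulmx1 -e' mulmxDr mulmxA mul_resolvent mul1mx.
have -> : Phi = U + V *m (cst_tfm (sysC S) *m U' + transfer S *m V').
  by rewrite -PhiB -[LHS]mul1mx -e mulmxDl -!mulmxA mul_pencil mulmx1.
apply: regularD => //; apply: regularM => //; apply: regularD; apply: regularM => //.
exact: regular_cst.
Qed.

Lemma closed_loopE n q m p (P : system C n m p) (K : system C q p m) :
  closed_loop P K = block_mx (sysA P) 0 0 (sysA K) +
    block_mx (sysB P) 0 0 (sysB K) *m block_mx 0 1%:M 1%:M 0
      *m block_mx (sysC P) 0 0 (sysC K).
Proof.
rewrite !mulmx_block !(mulmx0, mul0mx, addr0, add0r, mulmx1) add_block_mx.
by rewrite !(addr0, add0r).
Qed.

(** Feedback preserves minimality, so the closed loop has no eigenvalue besides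
    the poles of its transfer matrix. *)
Theorem hurwitz_feedback n q m p (P : system R n m p) (K : system R q p m) :
  minimal P -> minimal K ->
  (forall s, 0 <= complex.Re s ->
    regular (transfer (feedback (complexify P) (complexify K))) s) ->
  hurwitz (closed_loop P K).
Proof.
move=> [cP oP] [cK oK] rT; apply/hurwitzP => s /rT {}rT.
have -> : map_mx toC (closed_loop P K) =
    sysA (feedback (complexify P) (complexify K)).
  by rewrite -complexify_feedback.
apply: bezout_resolvent_regular rT; rewrite /= closed_loopE.
  by apply/right_bezout_feedback/right_bezout_diag; exact: right_bezout_controllable.
by apply/left_bezout_feedback/left_bezout_diag; exact: left_bezout_observable.
Qed.

End Minimality.

(** * Minimal real realizations *)

Section Realizations.
Variable R : realType.
Local Notation C := R[i].
Local Notation toC := (real_complex R).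

Section Generic.
Variable F : fieldType.

(** Cayley-Hamilton brings [D A^n] back into the span of the lower powers. *)
Lemma mxcol_stable n p (A : 'M[F]_n) (D : 'M[F]_(p, n)) :
  let O := \mxcol_(i < n) (D *m A ^+ i) in
  (O *m A <= O)%MS /\ (D <= O)%MS.
Proof.
move=> O.
have OA i : (i < n)%N -> (D *m A ^+ i <= O)%MS.
  move=> ltin; have <- := mxcolK (fun i : 'I_n => D *m A ^+ i) (Ordinal ltin).
  by rewrite -/O -(mul1mx O) -submxcol_mul mul1mx submxMl.
have OAn : (D *m A ^+ n <= O)%MS.
  case: n A D O OA => [|n] A D O OA; first by rewrite thinmx0 sub0mx.
  have := Cayley_Hamilton A; rewrite -[char_poly A]coefK poly_def size_char_poly.
  rewrite raddf_sum big_ord_recr /= linearZ rmorphXn /= horner_mx_X.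
  have -> : (char_poly A)`_n.+1 = 1.
    by have /monicP := char_poly_monic A; rewrite lead_coefE size_char_poly.
  rewrite scale1r addrC => /eqP; rewrite addr_eq0 => /eqP ->.
  rewrite mulmxN eqmx_opp mulmx_sumr; apply: summx_sub => i _.
  by rewrite linearZ rmorphXn /= horner_mx_X -scalemxAr scalemx_sub // OA.
split.
  have -> : O *m A = \mxcol_(i < n) (D *m A ^+ i *m A) by rewrite mxcol_mul.
  have /choice[d dE] : forall i : 'I_n, exists d, D *m A ^+ i *m A = d *m O.
    move=> i; apply/submxP; rewrite -mulmxA -[_ *m A]/(_ * _) -exprSr.
    by have := ltn_ord i; rewrite leq_eqVlt => /predU1P[->|/OA].
  by under eq_mxcol do rewrite dE; rewrite -mxcol_mul submxMl.
case: n A D O OA OAn => [|n] A D O OA _; first by rewrite thinmx0 sub0mx.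
by have := OA 0%N isT; rewrite expr0 mulmx1.
Qed.

(** The states seen from the output form a quotient of the state space on which
    the same input-output map is realized. *)
Lemma unobservable_reduction n m p (S : system F n m p) :
  ~ observable (sysC S) (sysA S) ->
  exists k (S' : system F k m p) (T : 'M[F]_(k, n)), (k < n)%N /\
    [/\ sysA S' *m T = T *m sysA S, T *m sysB S = sysB S' & sysC S' *m T = sysC S].
Proof.
move=> nobs; have [] := mxcol_stable (sysA S) (sysC S); set O := mxcol _ => OA CO.
have kn : (\rank O < n)%N.
  by rewrite ltn_neqAle rank_leq_col andbT; apply/eqP.
set T := row_base O.
have TA : (T *m sysA S <= T)%MS.
  by rewrite eq_row_base (submx_trans _ OA) // submxMr // eq_row_base.
have CT : (sysC S <= T)%MS by rewrite eq_row_base.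
exists _, (System (T *m sysA S *m pinvmx T) (T *m sysB S) (sysC S *m pinvmx T)), T.
by rewrite /= !mulmxKpV.
Qed.

Definition dual_system n m p (S : system F n m p) : system F n p m :=
  System (sysA S)^T (sysC S)^T (sysB S)^T.

(** Cramer: the transfer matrix is this polynomial matrix divided by the
    characteristic polynomial. *)
Definition numerator n m p (S : system F n m p) : 'M[{poly F}]_(p, m) :=
  map_mx polyC (sysC S) *m \adj (char_poly_mx (sysA S)) *m map_mx polyC (sysB S).

End Generic.

Definition map_system (F F' : fieldType) (f : F -> F') n m p (S : system F n m p) :
    system F' n m p :=
  System (map_mx f (sysA S)) (map_mx f (sysB S)) (map_mx f (sysC S)).

Lemma numerator_map (F F' : fieldType) (f : {rmorphism F -> F'}) n m p
    (S : system F n m p) :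
  numerator (map_system f S) = map_mx (map_poly f) (numerator S).
Proof.
rewrite /numerator !map_mxM /= map_mx_adj map_char_poly_mx.
by congr (_ *m _ *m _); apply/matrixP => i j; rewrite !mxE map_polyC.
Qed.

Lemma transfer_numerator n m p (S : system C n m p) i j :
  transfer S i j = tofrac (numerator S i j) / tofrac (char_poly (sysA S)).
Proof.
have -> : transfer S = (tofrac (char_poly (sysA S)))^-1 *:
    map_mx (@tofrac _) (numerator S).
  have -> : tofrac (char_poly (sysA S)) = \det (pencil (sysA S)).
    by rewrite det_map_mx.
  rewrite transferE /resolvent /invmx pencil_unit /numerator !map_mxM map_mx_adj.
  by rewrite -!cst_tfmE -scalemxAr -scalemxAl.
by rewrite !mxE mulrC.
Qed.

Lemma char_poly_neq0 n (A : 'M[C]_n) : char_poly A != 0.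
Proof. by rewrite -size_poly_eq0 size_char_poly. Qed.

Lemma transfer_dual n m p (S : system C n m p) :
  transfer (dual_system S) = (transfer S)^T.
Proof.
rewrite !transferE /= !trmx_mul !cst_tfm_tr mulmxA; congr (_ *m _ *m _).
by rewrite /resolvent pencil_tr trmx_inv.
Qed.

Lemma transfer_complexify_intertwine n k m p (S : system R n m p)
    (S' : system R k m p) (T : 'M[R]_(k, n)) :
  sysA S' *m T = T *m sysA S -> T *m sysB S = sysB S' -> sysC S' *m T = sysC S ->
  transfer (complexify S') = transfer (complexify S).
Proof.
move=> eA eB eC; apply: (@transfer_intertwine _ _ _ _ _ _ _ (map_mx toC T)) => /=;
  by rewrite -!map_mxM ?eA ?eB ?eC.
Qed.

(** Induction on the state dimension: an unobservable system is replaced by its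
    observable quotient, an uncontrollable one is first transposed. *)
Theorem minimal_realization n m p (S : system R n m p) :
  exists q (S' : system R q m p),
    minimal S' /\ transfer (complexify S') = transfer (complexify S).
Proof.
elim/ltn_ind: n S => n IHn S.
have [oS|/unobservable_reduction[k [S' [T [kn [eA eB eC]]]]]] :=
    pselect (observable (sysC S) (sysA S)); last first.
  have [q [S'' [mS'' e]]] := IHn _ kn S'; exists q, S''; split=> //.
  by rewrite e; exact: transfer_complexify_intertwine eA eB eC.
have [cS|] := pselect (controllable (sysA S) (sysB S)); first by exists n, S.
move=> ncS; have : ~ observable (sysC (dual_system S)) (sysA (dual_system S)).
  by move=> /observable_tr; rewrite /= !trmxK.
move=> /unobservable_reduction[k [S' [T [kn [eA eB eC]]]]].
have [q [S'' [mS'' e]]] := IHn _ kn (dual_system S'); exists q, S''; split=> //.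
have cdual a b c (U : system R a b c) :
  complexify (dual_system U) = dual_system (complexify U).
  by congr System; rewrite /= map_trmx.
rewrite e cdual transfer_dual (transfer_complexify_intertwine eA eB eC).
by rewrite cdual transfer_dual trmxK.
Qed.

Lemma real_rational_transfer n m p (S : system R n m p) :
  real_rational (transfer (complexify S)).
Proof.
move=> i j; exists (numerator S i j), (char_poly (sysA S)); split.
  by rewrite -size_poly_eq0 size_char_poly.
rewrite transfer_numerator; congr (tofrac _ / tofrac _).
  by rewrite (numerator_map toC) mxE.
by rewrite map_char_poly.
Qed.

Lemma real_rationalB p m (F G : tfm R p m) :
  real_rational F -> real_rational G -> real_rational (F - G).
Proof.
move=> rF rG i j; have [a [b [b0 fE]]] := rF i j; have [a' [b' [b0' gE]]] := rG i j.
have h (c : {poly R}) : c != 0 -> tofrac (map_poly toC c) != 0.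
  by move=> c0; rewrite tofrac_eq0 map_poly_eq0.
exists (a * b' - a' * b), (b * b'); split; first by rewrite mulf_neq0.
rewrite !mxE fE gE -mulNr (addf_div _ _ (h _ b0) (h _ b0')).
by rewrite rmorphB !rmorphM /= rmorphB !rmorphM /= mulNr.
Qed.

(** Write an entry both as [N / chi] and as a quotient [a / b] of real polynomials:
    conjugation turns [N b = a chi] into the same identity for the conjugate system. *)
Lemma transfer_conj n m p (S : system C n m p) : real_rational (transfer S) ->
  transfer (map_system conjc S) = transfer S.
Proof.
move=> rS; apply/matrixP => i j; have [a [b [b0 fE]]] := rS i j.
have b0' : map_poly toC b != 0 by rewrite map_poly_eq0.
have := fE; rewrite [in X in X -> _]transfer_numerator.
move=> /(frac_eq _ _ (char_poly_neq0 _) b0') e.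
rewrite fE transfer_numerator; apply/(frac_eq _ _ (char_poly_neq0 _) b0').
rewrite (numerator_map conjc) mxE -(map_conjc_real a) -(map_conjc_real b).
rewrite -rmorphM e rmorphM; congr (_ * _); exact: map_char_poly.
Qed.

(** Real and imaginary parts of the state evolve under the matrix
    [Ar, -Ai; Ai, Ar], which over [C] is conjugate to [diag (A, conj A)]; reading
    the real part of the output realizes the mean of [H] and [conj H]. *)
Lemma real_realization n m p (S : system C n m p) : real_rational (transfer S) ->
  exists S' : system R (n + n) m p, transfer (complexify S') = transfer S.
Proof.
move=> rS; pose re k l (M : 'M[C]_(k, l)) := map_mx (@complex.Re R) M.
pose im k l (M : 'M[C]_(k, l)) := map_mx (@complex.Im R) M.
pose S' : system R (n + n) m p :=
  System (block_mx (re _ _ (sysA S)) (- im _ _ (sysA S))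
                   (im _ _ (sysA S)) (re _ _ (sysA S)))
    (col_mx (re _ _ (sysB S)) (im _ _ (sysB S)))
    (row_mx (re _ _ (sysC S)) (- im _ _ (sysC S))).
exists S'.
pose half k (U : system C k m p) := System (sysA U) (sysB U) (2^-1 *: sysC U).
have halfE k (U : system C k m p) : transfer (half k U) = tofrac (2^-1)%:P *: transfer U.
  rewrite !transferE /=.
  have -> : cst_tfm (2^-1 *: sysC U) = tofrac (2^-1)%:P *: cst_tfm (sysC U).
    by apply/matrixP => i j; rewrite !mxE polyCM tofracM.
  by rewrite -!scalemxAl.
have h2 : 2^-1 + 2^-1 = 1 :> C.
  by rewrite -mulr2n -[LHS]mulr_natr mulVf // pnatr_eq0.
have i2 : 'i%C * 'i%C = -1 :> C by rewrite -expr2 sqr_i.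
(* The coordinates [x + i y] and [x - i y] separate the state into two copies, of
   [S] and of its conjugate. *)
rewrite -(@transfer_intertwine _ _ _ _ _
  (parallel (half _ S) (half _ (map_system conjc S))) _
  (block_mx 1%:M 'i%C%:M 1%:M (- 'i%C%:M))).
- rewrite transfer_parallel !halfE (transfer_conj rS) -scalerDl -tofracD -polyCD.
  by rewrite h2 tofrac1 scale1r.
- rewrite /= map_block_mx !mulmx_block !(mul1mx, mulmx1, mul0mx, add0r, addr0).
  rewrite !mulNmx !mul_scalar_mx !mulmxN !mul_mx_scalar; congr block_mx;
  apply/matrixP => k l; rewrite !mxE; case: (sysA S k l) => a b;
  apply/eqP; rewrite eq_complex /=; apply/andP; split; apply/eqP; ring.
- rewrite /= map_col_mx mul_block_col !mul1mx mulNmx mul_scalar_mx; congr col_mx;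
  apply/matrixP => k l; rewrite !mxE; case: (sysB S k l) => a b;
  apply/eqP; rewrite eq_complex /=; apply/andP; split; apply/eqP; ring.
- rewrite /= map_row_mx mul_row_block !mulmx1 mulmxN !mul_mx_scalar; congr row_mx;
  apply/matrixP => k l; rewrite !mxE; case: (sysC S k l) => a b;
  apply/eqP; rewrite eq_complex /=; apply/andP; split; apply/eqP; by field.

Qed.

End Realizations.

(** * The Frobenius norm *)

Section Frobenius.
Variable R : realType.
Local Notation C := R[i].

Definition ctr n m (M : 'M[C]_(n, m)) : 'M[C]_(m, n) := (map_mx Num.conj M)^T.

Lemma ctrK n m (M : 'M[C]_(n, m)) : ctr (ctr M) = M.
Proof. by apply/matrixP => i j; rewrite !mxE conjCK. Qed.

Lemma ctrM n m p (M : 'M[C]_(n, m)) (N : 'M[C]_(m, p)) :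
  ctr (M *m N) = ctr N *m ctr M.
Proof. by rewrite /ctr map_mxM trmx_mul. Qed.

Definition fdot n m (A B : 'M[C]_(n, m)) : R := complex.Re (\tr (ctr A *m B)).

Definition fnorm n m (A : 'M[C]_(n, m)) : R := Num.sqrt (fdot A A).

Lemma ReD (x y : C) : complex.Re (x + y) = complex.Re x + complex.Re y.
Proof. by case: x; case: y. Qed.

Lemma Re_sum (I : Type) (r : seq I) (P : pred I) (F : I -> C) :
  complex.Re (\sum_(i <- r | P i) F i) = \sum_(i <- r | P i) complex.Re (F i).
Proof. by apply: (big_morph _ ReD). Qed.

Lemma fdotE n m (A B : 'M[C]_(n, m)) :
  fdot A B = \sum_i \sum_j complex.Re ((A i j)^* * B i j).
Proof.
rewrite /fdot /mxtrace Re_sum exchange_big; apply: eq_bigr => j _.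
by rewrite !mxE Re_sum; apply: eq_bigr => i _; rewrite !mxE.
Qed.

Lemma Re_conjM (x : C) : complex.Re (x^* * x) = complex.Re x ^+ 2 + complex.Im x ^+ 2.
Proof. by case: x => a b; rewrite [_^*]/=; rewrite /= mulNr opprK !expr2. Qed.

Lemma fdot_ge0 n m (A : 'M[C]_(n, m)) : 0 <= fdot A A.
Proof.
rewrite fdotE; apply: sumr_ge0 => i _; apply: sumr_ge0 => j _.
by rewrite Re_conjM addr_ge0 ?sqr_ge0.
Qed.

Lemma fdotC n m (A B : 'M[C]_(n, m)) : fdot A B = fdot B A.
Proof.
rewrite !fdotE; apply: eq_bigr => i _; apply: eq_bigr => j _.
case: (A i j) (B i j) => [a b] [c d].
by rewrite [_^*]/= [X in _ = complex.Re (X * _)]/= /=; ring.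
Qed.

Lemma fdotDr n m (A B D : 'M[C]_(n, m)) : fdot A (B + D) = fdot A B + fdot A D.
Proof. by rewrite /fdot mulmxDr linearD ReD. Qed.

Lemma fdotNr n m (A B : 'M[C]_(n, m)) : fdot A (- B) = - fdot A B.
Proof. by rewrite /fdot mulmxN linearN /=; case: (\tr _). Qed.

Lemma fdotZr n m (t : R) (A B : 'M[C]_(n, m)) :
  fdot A (real_complex R t *: B) = t * fdot A B.
Proof.
by rewrite /fdot -scalemxAr linearZ /=; case: (\tr _) => a b /=; rewrite mul0r subr0.
Qed.

Lemma fdotDl n m (A B D : 'M[C]_(n, m)) : fdot (A + B) D = fdot A D + fdot B D.
Proof. by rewrite fdotC fdotDr ![fdot D _]fdotC. Qed.

Lemma fdotZl n m (t : R) (A B : 'M[C]_(n, m)) :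
  fdot (real_complex R t *: A) B = t * fdot A B.
Proof. by rewrite fdotC fdotZr fdotC. Qed.

Lemma fdot_adj n m p (M : 'M[C]_(n, m)) (A : 'M[C]_(m, p)) (B : 'M[C]_(n, p)) :
  fdot (M *m A) B = fdot A (ctr M *m B).
Proof. by rewrite /fdot ctrM mulmxA. Qed.

Lemma fdot_ctr n m (A B : 'M[C]_(n, m)) : fdot (ctr A) (ctr B) = fdot A B.
Proof. by rewrite fdotC /fdot ctrK mxtrace_mulC. Qed.

Lemma fnorm_ge0 n m (A : 'M[C]_(n, m)) : 0 <= fnorm A.
Proof. exact: sqrtr_ge0. Qed.

Lemma sqr_fnorm n m (A : 'M[C]_(n, m)) : fnorm A ^+ 2 = fdot A A.
Proof. by rewrite sqr_sqrtr // fdot_ge0. Qed.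

Lemma fnorm_ctr n m (A : 'M[C]_(n, m)) : fnorm (ctr A) = fnorm A.
Proof. by rewrite /fnorm fdot_ctr. Qed.

(** The form [|x A - y B|^2] is nonnegative for all real [x] and [y]. *)
Lemma fdot_cauchy n m (A B : 'M[C]_(n, m)) : fdot A B <= fnorm A * fnorm B.
Proof.
set a := fnorm A; set b := fnorm B.
have a0 : 0 <= a by exact: fnorm_ge0.
have b0 : 0 <= b by exact: fnorm_ge0.
have aE : fdot A A = a ^+ 2 by rewrite sqr_fnorm.
have bE : fdot B B = b ^+ 2 by rewrite sqr_fnorm.
have quad (x y : R) : 2 * x * y * fdot A B <= x ^+ 2 * a ^+ 2 + y ^+ 2 * b ^+ 2.
  have := fdot_ge0 (real_complex R x *: A + real_complex R (- y) *: B).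
  rewrite !fdotDr !fdotDl !fdotZl !fdotZr aE bE (fdotC B A); lra.
have [a_gt0|a_le0] := ltP 0 a; last first.
  have a00 : a = 0 by apply/eqP; rewrite eq_le a_le0 a0.
  rewrite a00 mul0r leNgt; apply/negP => ab.
  have := quad ((b ^+ 2 + 1) / fdot A B) 1.
  have -> : 2 * ((b ^+ 2 + 1) / fdot A B) * 1 * fdot A B = 2 * (b ^+ 2 + 1).
    by field; rewrite gt_eqF.
  by rewrite a00; have := sqr_ge0 b; lra.
have [b_gt0|b_le0] := ltP 0 b; last first.
  have b00 : b = 0 by apply/eqP; rewrite eq_le b_le0 b0.
  rewrite b00 mulr0 leNgt; apply/negP => ab.
  have := quad 1 ((a ^+ 2 + 1) / fdot A B).
  have -> : 2 * 1 * ((a ^+ 2 + 1) / fdot A B) * fdot A B = 2 * (a ^+ 2 + 1).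
    by field; rewrite gt_eqF.
  by rewrite b00; have := sqr_ge0 a; lra.
have := quad b a; have -> : b ^+ 2 * a ^+ 2 + a ^+ 2 * b ^+ 2 = 2 * b * a * (a * b).
  by ring.
by rewrite ler_pM2l // !mulr_gt0.
Qed.

Lemma fnormD n m (A B : 'M[C]_(n, m)) : fnorm (A + B) <= fnorm A + fnorm B.
Proof.
rewrite -(@ler_pXn2r _ 2) ?nnegrE ?addr_ge0 ?fnorm_ge0 //.
rewrite sqr_fnorm fdotDl !fdotDr sqrrD !sqr_fnorm (fdotC B A).
by have := fdot_cauchy A B; lra.
Qed.

Lemma fnormN n m (A : 'M[C]_(n, m)) : fnorm (- A) = fnorm A.
Proof. by rewrite /fnorm fdotNr fdotC fdotNr opprK. Qed.

Lemma fnorm_eq0 n m (A : 'M[C]_(n, m)) : fnorm A = 0 -> A = 0.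
Proof.
move=> A0; apply/matrixP => i j; rewrite mxE.
have := sqr_fnorm A; rewrite A0 expr0n /= fdotE => /esym/eqP.
rewrite psumr_eq0 => [/allP/(_ i (mem_index_enum _))|k _]; last first.
  by apply: sumr_ge0 => l _; rewrite Re_conjM addr_ge0 ?sqr_ge0.
rewrite psumr_eq0 => [/allP/(_ j (mem_index_enum _))|k _]; last first.
  by rewrite Re_conjM addr_ge0 ?sqr_ge0.
rewrite Re_conjM paddr_eq0 ?sqr_ge0 // !sqrf_eq0 => /andP[re im].
by apply/eqP; rewrite eq_complex re im.
Qed.

End Frobenius.

(** * The largest singular value as an operator norm *)

Section SigmaMax.
Variable R : realType.
Local Notation C := R[i].
Local Notation toC := (real_complex R).

Lemma tr_ctr_mul n m (A : 'M[C]_(n, m)) : \tr (ctr A *m A) = toC (fdot A A).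
Proof.
rewrite /fdot; set t := \tr _; suff : complex.Im t = 0 by case: t => a b /= ->.
rewrite /t /mxtrace (big_morph (@complex.Im R) (id1 := 0) (op1 := +%R)) //; last first.
  by case=> ? ? [].
apply: big1 => j _; rewrite mxE (big_morph (@complex.Im R) (id1 := 0) (op1 := +%R)) //.
  apply: big1 => i _; rewrite !mxE; case: (A i j) => a b.
  by rewrite [_^*]/= /=; ring.
by case=> ? ? [].
Qed.

Lemma fnorm_outer n m (W : 'cV[C]_n) (V : 'cV[C]_m) :
  fnorm (W *m ctr V) = fnorm W * fnorm V.
Proof.
rewrite /fnorm -sqrtrM ?fdot_ge0 //; congr (Num.sqrt _).
have tr11 (X Y : 'M[C]_1) : \tr (X *m Y) = \tr X * \tr Y.
  by rewrite !trace_mx11 mxE big_ord1.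
rewrite {1}/fdot ctrM ctrK -mulmxA mxtrace_mulC -mulmxA -[_ *m ctr V *m V]mulmxA.
by rewrite (mulmxA (ctr W)) tr11 !tr_ctr_mul -rmorphM.
Qed.

Lemma fnorm_mul_cV p m (M : 'M[C]_(p, m)) (V : 'cV[C]_m) :
  fnorm (M *m V) <= fnorm M * fnorm V.
Proof.
have [t_gt0|] := ltP 0 (fnorm (M *m V)); last first.
  by move=> /le_trans; apply; rewrite mulr_ge0 // fnorm_ge0.
rewrite -(ler_pM2l t_gt0) -expr2 sqr_fnorm.
have -> : fdot (M *m V) (M *m V) = fdot M (M *m V *m ctr V).
  by rewrite {1}/fdot ctrM mxtrace_mulC /fdot !mulmxA mxtrace_mulC !mulmxA.
apply: le_trans (fdot_cauchy _ _) _.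
by rewrite fnorm_outer mulrCA.
Qed.

(** With [u = v^*], [|M u|^2] is [v M^* M v^*]: an eigenvalue of [M^* M] is the
    ratio [|M u|^2 / |u|^2], real and nonnegative. *)
Lemma fdot_eigen p m (M : 'M[C]_(p, m)) (v : 'rV[C]_m) (l : C) :
  v *m (ctr M *m M) = l *: v ->
  toC (fdot (M *m ctr v) (M *m ctr v)) = l * toC (fdot v v).
Proof.
move=> e; rewrite -tr_ctr_mul ctrM ctrK mulmxA -[v *m _ *m M]mulmxA e.
by rewrite -scalemxAl linearZ /= mxtrace_mulC tr_ctr_mul.
Qed.

Local Notation singular M := [set x : R | 0 <= x /\
  eigenvalue (ctr M *m M) (toC (x ^+ 2))]%classic.

Lemma singular_le p m (M : 'M[C]_(p, m)) (c : R) : 0 <= c ->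
  (forall V : 'cV[C]_m, fnorm (M *m V) <= c * fnorm V) -> ubound (singular M) c.
Proof.
move=> c0 Mc x [x0 /eigenvalueP[v /fdot_eigen e v0]].
have v_gt0 : 0 < fnorm v.
  by rewrite lt_neqAle fnorm_ge0 andbT eq_sym; apply: contra_neq v0 => /fnorm_eq0.
have {}e : fnorm (M *m ctr v) = x * fnorm v.
  move: e; rewrite -rmorphM => -[]; rewrite -!sqr_fnorm -exprMn => /eqP.
  by rewrite eqrXn2 ?fnorm_ge0 ?mulr_ge0 ?fnorm_ge0 // => /eqP.
by rewrite -(ler_pM2r v_gt0) -e -[fnorm v]fnorm_ctr.
Qed.

Lemma sigma_max_le p m (M : 'M[C]_(p, m)) (c : R) : 0 <= c ->
  (forall V : 'cV[C]_m, fnorm (M *m V) <= c * fnorm V) -> sigma_max M <= c.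
Proof.
move=> c0 /(singular_le c0) Mc; rewrite /sigma_max -/(ctr M).
have [->|/set0P ne] := eqVneq (singular M) set0; first by rewrite sup0.
exact: ge_sup.
Qed.

Lemma sigma_max_ub p m (M : 'M[C]_(p, m)) x : singular M x -> x <= sigma_max M.
Proof.
move=> Mx; apply: ub_le_sup Mx; exists (fnorm M); apply: singular_le => [|V].
  exact: fnorm_ge0.
exact: fnorm_mul_cV.
Qed.

Lemma sigma_max_ge0 p m (M : 'M[C]_(p, m)) : 0 <= sigma_max M.
Proof.
have [e|/set0P[x Mx]] := eqVneq (singular M) set0; last first.
  by apply: le_trans (sigma_max_ub Mx); case: Mx.
by rewrite /sigma_max -/(ctr M) e sup0.
Qed.

(** In a unitary eigenbasis of [M^* M] the squared norm of [M V] is a combination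
    of squared norms whose weights are squares of singular values. *)
Theorem fnorm_mul_sigma p m k (M : 'M[C]_(p, m)) (V : 'M[C]_(m, k)) :
  fnorm (M *m V) <= sigma_max M * fnorm V.
Proof.
set H := ctr M *m M; set s := sigma_max M.
have s0 : 0 <= s by exact: sigma_max_ge0.
have HH : ctr H = H by rewrite /H ctrM ctrK.
have nH : H \is normalmx.
  by apply/normalmxP; rewrite -map_trmx -/(ctr H) HH.
have /unitarymxP := spectral_unitarymx H.
set U := spectralmx H; rewrite -map_trmx -/(ctr U) => UU.
have [uU _] := mulmx1_unit UU.
have UV : ctr U *m U = 1%:M by exact: mulmx1C.
have HE : U *m H = diag_mx (spectral_diag H) *m U.
  have /orthomx_spectralP e := nH.
  by rewrite {1}e -/U !mulmxA (mulmxV uU) mul1mx.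
set d := spectral_diag H in HE.
(* The rows of [U] are eigenvectors, so each [d 0 i] is the square of a singular
   value. *)
have de i : toC (complex.Re (d 0 i)) = d 0 i /\ complex.Re (d 0 i) <= s ^+ 2.
  have ri : row i U *m H = d 0 i *: row i U.
    by rewrite -row_mul HE mul_diag_mx; apply/rowP => j; rewrite !mxE.
  have r0 : row i U != 0.
    apply/eqP => r0; have := congr1 (fun X => (row i X) 0 i) UU.
    by rewrite row_mul r0 mul0mx !mxE eqxx => /esym/eqP; rewrite oner_eq0.
  have r_gt0 : 0 < fdot (row i U) (row i U).
    rewrite -sqr_fnorm exprn_gt0 // lt_neqAle fnorm_ge0 andbT eq_sym.
    by apply: contra_neq r0 => /fnorm_eq0.
  have e := fdot_eigen ri; set q := fdot (M *m _) _ in e.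
  have dE : d 0 i = toC (q / fdot (row i U) (row i U)).
    apply: (@mulIf _ (toC (fdot (row i U) (row i U)))).
      by rewrite fmorph_eq0 gt_eqF.
    by rewrite -e -rmorphM divfK // gt_eqF.
  have q0 : 0 <= q by exact: fdot_ge0.
  have qd : 0 <= q / fdot (row i U) (row i U) by rewrite divr_ge0 // ltW.
  rewrite dE; split; first by [].
  rewrite /= -(sqr_sqrtr qd) ler_pXn2r ?nnegrE ?sqrtr_ge0 //.
  apply: sigma_max_ub; split; first exact: sqrtr_ge0.
  by apply/eigenvalueP; exists (row i U) => //; rewrite sqr_sqrtr // -dE.
rewrite -(@ler_pXn2r _ 2) ?nnegrE ?mulr_ge0 ?fnorm_ge0 // exprMn !sqr_fnorm.
rewrite fdot_adj mulmxA -/H.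
have -> : fdot V (H *m V) = fdot (U *m V) (diag_mx d *m (U *m V)).
  by rewrite mulmxA -HE fdot_adj !mulmxA UV mul1mx.
have -> : fdot V V = fdot (U *m V) (U *m V) by rewrite fdot_adj mulmxA UV mul1mx.
move: (U *m V) => W; rewrite !fdotE mulr_sumr; apply: ler_sum => i _.
rewrite mulr_sumr mul_diag_mx; apply: ler_sum => j _; rewrite mxE; have [dE ds] := de i.
set z := W i j; have -> : complex.Re (z^* * (d 0 i * z)) =
  complex.Re (d 0 i) * complex.Re (z^* * z).
  by rewrite mulrCA -{1}dE; case: (z^* * z) => a b /=; rewrite mul0r subr0.
by rewrite ler_wpM2r // Re_conjM addr_ge0 ?sqr_ge0.
Qed.

(** [|M^* W|^2] is the inner product of [W] and [M M^* W], so the bound for [M]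
    carries over to [M^*]. *)
Theorem fnorm_sigma_mul p m k (V : 'M[C]_(k, p)) (M : 'M[C]_(p, m)) :
  fnorm (V *m M) <= sigma_max M * fnorm V.
Proof.
rewrite -(fnorm_ctr (V *m M)) ctrM -(fnorm_ctr V).
set W := ctr V; set T := ctr M *m W.
have [t_gt0|] := ltP 0 (fnorm T); last first.
  by move=> /le_trans; apply; rewrite mulr_ge0 ?fnorm_ge0 ?sigma_max_ge0.
rewrite -(ler_pM2l t_gt0) -expr2 sqr_fnorm {1}/T fdot_adj ctrK.
apply: le_trans (fdot_cauchy _ _) _.
rewrite mulrC mulrA ler_wpM2r ?fnorm_ge0 // mulrC; exact: fnorm_mul_sigma.
Qed.

Lemma sigma_max_le_fnorm p m (M : 'M[C]_(p, m)) : sigma_max M <= fnorm M.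
Proof. by apply: sigma_max_le (fnorm_ge0 _) _ => V; exact: fnorm_mul_cV. Qed.

End SigmaMax.

(** * The maximum modulus principle on the right half-plane *)

Section Modulus.
Variable R : realType.
Local Notation C := R[i].
Local Notation toC := (real_complex R).
Implicit Types (z s : C) (p a b : {poly C}).

Lemma sqr_normc_ReIm z : normc z ^+ 2 = complex.Re z ^+ 2 + complex.Im z ^+ 2.
Proof. by case: z => x y /=; rewrite sqr_sqrtr // addr_ge0 ?sqr_ge0. Qed.

Lemma normc_ge0 z : 0 <= normc z.
Proof. by case: z => x y /=; exact: sqrtr_ge0. Qed.

Lemma normc_gt0 z : (0 < normc z) = (z != 0).
Proof.
rewrite lt_neqAle normc_ge0 andbT eq_sym; congr (~~ _).
by apply/eqP/eqP => [/eq0_normc|->]; last exact: normc0.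
Qed.

Lemma normcB_le z s : normc z <= normc (z - s) + normc s.
Proof. by rewrite -{1}(subrK s z); exact: le_normcD. Qed.

Lemma Re_le_normc z : `|complex.Re z| <= normc z.
Proof.
by rewrite -(@ler_pXn2r _ 2) ?nnegrE ?normc_ge0 // real_normK ?num_real //
  sqr_normc_ReIm lerDl sqr_ge0.
Qed.

Lemma Im_le_normc z : `|complex.Im z| <= normc z.
Proof.
by rewrite -(@ler_pXn2r _ 2) ?nnegrE ?normc_ge0 // real_normK ?num_real //
  sqr_normc_ReIm lerDr sqr_ge0.
Qed.

Lemma normcX z n : normc (z ^+ n) = normc z ^+ n.
Proof. by elim: n => [|n IHn]; rewrite ?normc1 // !exprS normcM IHn. Qed.

(** [|s - r|] is at least [- Re r] and at least [|s| - |r|]; a suitable combination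
    of the two bounds is a multiple of [1 + |s|]. *)
Lemma distance_lower_bound r : complex.Re r < 0 -> exists2 c : R, 0 < c &
  forall s, 0 <= complex.Re s -> c * (1 + normc s) <= normc (s - r).
Proof.
move=> r0; set d := - complex.Re r.
have d0 : 0 < d by rewrite oppr_gt0.
have n0 := normc_ge0 r.
have D0 : 0 < d + 1 + normc r by lra.
exists (d / (d + 1 + normc r)); first by rewrite divr_gt0.
move=> s s0; rewrite mulrAC ler_pdivrMr //.
have h1 : d <= normc (s - r).
  apply: le_trans (Re_le_normc _); apply: le_trans (ler_norm _).
  by rewrite /d; case: s s0 => ? ?; case: (r) => ? ? /=; lra.
have h2 := normcB_le s r.
have := ler_pM2l d0 (normc s) (normc (s - r) + normc r); rewrite h2 => h3.
have : d * (1 + normc r) <= normc (s - r) * (1 + normc r).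
  by rewrite ler_wpM2r //; lra.
by lra.
Qed.

Lemma horner_upper_bound p n : (size p <= n.+1)%N -> exists2 M : R, 0 <= M &
  forall s, normc p.[s] <= M * (1 + normc s) ^+ n.
Proof.
move=> pn; exists (\sum_(i < size p) normc p`_i).
  by apply: sumr_ge0 => i _; exact: normc_ge0.
move=> s; rewrite horner_coef mulr_suml.
have sub (I : Type) (r : seq I) (F : I -> C) :
    normc (\sum_(i <- r) F i) <= \sum_(i <- r) normc (F i).
  elim: r => [|i r IHr]; first by rewrite !big_nil normc0.
  by rewrite !big_cons (le_trans (le_normcD _ _)) // lerD2l.
apply: le_trans (sub _ _ _) _; apply: ler_sum => i _; rewrite normcM normcX.
have s0 := normc_ge0 s; apply: ler_wpM2l; first exact: normc_ge0.
have ltin : (i <= n)%N by rewrite -ltnS (leq_trans (ltn_ord i)).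
apply: (@le_trans _ _ ((1 + normc s) ^+ i)).
  by apply: lerXn2r; rewrite ?nnegrE //; lra.
by apply: ler_weXn2l => //; lra.
Qed.

(** Each root of the denominator contributes a factor that grows at least like
    [1 + |s|], and their number exceeds the degree of the numerator. *)
Lemma strictly_proper_decay a b : (size a < size b)%N ->
  (forall s, 0 <= complex.Re s -> ~~ root b s) ->
  exists2 M : R, 0 <= M &
    forall s, 0 <= complex.Re s -> normc (a.[s] / b.[s]) * (1 + normc s) <= M.
Proof.
move=> sab b0; have [rs bE] := closed_field_poly_normal b.
have lb : lead_coef b != 0.
  by rewrite lead_coef_eq0; apply: contraTneq sab => ->; rewrite size_poly0.
have sb : size b = (size rs).+1.
  by rewrite bE size_scale // size_prod_XsubC.
have rs0 : forall r, r \in rs -> complex.Re r < 0.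
  move=> r rrs; rewrite ltNge; apply/negP => /b0.
  by rewrite bE rootZ // root_prod_XsubC rrs.
have [c c0 cb] : exists2 c : R, 0 < c & forall s, 0 <= complex.Re s ->
    c * (1 + normc s) ^+ size rs <= normc (\prod_(r <- rs) ('X - r%:P)).[s].
  elim: rs rs0 {bE sb} => [|r rs IHrs] rs0.
    by exists 1 => // s _; rewrite big_nil hornerC normc1 mul1r.
  have [|c c0 cs] := IHrs; first by move=> x xrs; rewrite rs0 // inE xrs orbT.
  have [|d d0 ds] := @distance_lower_bound r; first by rewrite rs0 // mem_head.
  exists (d * c); first exact: mulr_gt0.
  move=> s s0; rewrite big_cons hornerM hornerXsubC normcM exprS mulrACA.
  have n0 := normc_ge0 s.
  by apply: ler_pM (ds _ s0) (cs _ s0); rewrite mulr_ge0 ?exprn_ge0 //; lra.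
have [->|a0] := eqVneq a 0.
  by exists 0 => // s _; rewrite horner0 mul0r normc0 mul0r.
have [k sk] : exists k, size rs = k.+1.
  move: sab; rewrite sb ltnS; case: (size rs) => [|k _]; last by exists k.
  by rewrite leqn0 size_poly_eq0 (negbTE a0).
have [|M M0 Ma] := @horner_upper_bound a k; first by rewrite -sk -ltnS -sb.
have l0 : 0 < normc (lead_coef b) by rewrite normc_gt0.
exists (M / (normc (lead_coef b) * c)); first by rewrite divr_ge0 // mulr_ge0 // ltW.
move=> s s0; have n0 := normc_ge0 s; have n1 : 0 < 1 + normc s by lra.
have bs : 0 < normc b.[s] by rewrite normc_gt0; exact: b0.
rewrite normcM normcV mulrAC ler_pdivrMr // mulrAC ler_pdivlMr ?mulr_gt0 //.
apply: (@le_trans _ _ (M * (1 + normc s) ^+ k * (1 + normc s) *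
    (normc (lead_coef b) * c))).
  by rewrite !ler_wpM2r ?Ma // ltW // mulr_gt0.
rewrite -!mulrA ler_wpM2l // [in normc b.[s]]bE hornerZ normcM.
rewrite mulrA -exprSr -sk mulrCA ler_wpM2l ?normc_ge0 //.
by rewrite mulrC; exact: cb.
Qed.

Definition cpx (z : R * R) : C := Complex z.1 z.2.

Lemma continuous_horner_cpx p :
  continuous (fun z : R * R => complex.Re p.[cpx z]) /\
  continuous (fun z : R * R => complex.Im p.[cpx z]).
Proof.
elim/poly_ind: p => [|p c [cRe cIm]].
  by split=> z; under eq_fun do rewrite horner0; exact: cst_continuous.
have c1 : continuous (fst : R * R -> R) by move=> z; exact: cvg_fst.
have c2 : continuous (snd : R * R -> R) by move=> z; exact: cvg_snd.
split.
  have -> : (fun z : R * R => complex.Re (p * 'X + c%:P).[cpx z]) =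
    (fun z : R * R => complex.Re p.[cpx z] * z.1 - complex.Im p.[cpx z] * z.2 + complex.Re c).
    by apply/funext => -[x y]; rewrite hornerMXaddC; case: p.[_] => ? ?; case: (c).
  move=> z; apply: cvgD; last exact: cvg_cst.
  by apply: cvgB; apply: cvgM; [exact: cRe|exact: c1|exact: cIm|exact: c2].
have -> : (fun z : R * R => complex.Im (p * 'X + c%:P).[cpx z]) =
  (fun z : R * R => complex.Re p.[cpx z] * z.2 + complex.Im p.[cpx z] * z.1 + complex.Im c).
  by apply/funext => -[x y]; rewrite hornerMXaddC; case: p.[_] => ? ?; case: (c).
move=> z; apply: cvgD; last exact: cvg_cst.
by apply: cvgD; apply: cvgM; [exact: cRe|exact: c2|exact: cIm|exact: c1].
Qed.


Lemma Re_div (x y : C) : complex.Re (x / y) = complex.Re (x * conjc y) / normc y ^+ 2.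
Proof. by rewrite sqr_normc_ReIm; case: x y => [x1 x2] [y1 y2] /=; ring. Qed.

(** A nonconstant rational function has no local maximum of its modulus: at a
    point where its value is [c] it equals [c (1 + t h^k (1 + o(1)))] at
    distance [h], with [t != 0], and some direction of [h] makes [t h^k]
    positive. *)
Lemma rational_no_local_max a b s0 : b.[s0] != 0 -> a.[s0] != 0 ->
  a != (a.[s0] / b.[s0]) *: b ->
  forall e : R, 0 < e -> exists s, [/\ normc (s - s0) < e, b.[s] != 0 &
    normc (a.[s0] / b.[s0]) < normc (a.[s] / b.[s])].
Proof.
move=> b0 a0 ab e e0; set c := a.[s0] / b.[s0].
have c0 : c != 0 by rewrite mulf_neq0 ?invr_eq0.
have Q0 : a - c *: b != 0 by rewrite subr_eq0.
have [k [q]] := multiplicity_XsubC (a - c *: b) s0.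
rewrite Q0 /= => /negP/negP qs QE.
have Qs : (a - c *: b).[s0] = 0.
  by rewrite hornerD hornerN hornerZ /c divfK // subrr.
have k0 : (0 < k)%N.
  rewrite lt0n; apply: contraNneq qs => kk.
  by move: Qs; rewrite QE kk expr0 mulr1 => /eqP.
have q0 : q.[s0] != 0 by [].
(* Along the direction [u] the leading term of [f / c - 1] is positive. *)
have [u uE] : exists u : C, u ^+ k = (q.[s0] / b.[s0] / c)^-1.
  have /closed_rootP[u] : size ('X^k - ((q.[s0] / b.[s0] / c)^-1)%:P) != 1%N.
    by rewrite size_XnsubC // eqSS -lt0n.
  by rewrite rootE !hornerE subr_eq0 => /eqP; exists u.
(* Up to a positive factor, [psi] is the real part of [(f / c - 1) / eps^k]. *)
pose psi (z : R * R) : R :=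
  complex.Re ((q * (b.[s0])%:P).[cpx z] * conjc ((q.[s0])%:P * b).[cpx z]).
have cpsi : continuous psi.
  have [f1 f2] := continuous_horner_cpx (q * (b.[s0])%:P).
  have [g1 g2] := continuous_horner_cpx ((q.[s0])%:P * b).
  have -> : psi = (fun z : R * R =>
    complex.Re (q * (b.[s0])%:P).[cpx z] * complex.Re ((q.[s0])%:P * b).[cpx z] +
    complex.Im (q * (b.[s0])%:P).[cpx z] * complex.Im ((q.[s0])%:P * b).[cpx z]).
    apply/funext => z; rewrite /psi.
    by case: (_.[_]) (_.[_]) => [x1 y1] [x2 y2] /=; rewrite mulrN opprK.
  by move=> z; apply: cvgD; apply: cvgM; [exact: f1|exact: g1|exact: f2|exact: g2].
pose z0 : R * R := (complex.Re s0, complex.Im s0).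
have z0E : cpx z0 = s0 by rewrite /cpx /z0 /=; case: (s0).
have psi0 : 0 < psi z0.
  rewrite /psi z0E !hornerM !hornerC.
  have -> : complex.Re (q.[s0] * b.[s0] * conjc (q.[s0] * b.[s0])) =
      normc (q.[s0] * b.[s0]) ^+ 2.
    by rewrite sqr_normc_ReIm; set w := q.[s0] * _; case: w => x y /=; ring.
  by rewrite exprn_gt0 // normc_gt0 mulf_neq0.
have /nbhs_ballP[d /= d0 dpsi] : \forall z \near z0, 0 < psi z.
  exact: (cvgr_gt _ (cpsi z0) _ psi0).
have u0 := normc_ge0 u.
have m0 : 0 < Num.min d e by rewrite lt_min d0.
pose eps := Num.min d e / (1 + normc u).
have eps0 : 0 < eps by rewrite divr_gt0 //; lra.
have epsu : normc (toC eps * u) < Num.min d e.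
  have -> : normc (toC eps * u) = eps * normc u.
    by rewrite normcM /= expr0n addr0 sqrtr_sqr gtr0_norm.
  by rewrite mulrAC ltr_pdivrMr ?ltr_pM2l //; lra.
set s := s0 + toC eps * u; exists s.
have ds : s - s0 = toC eps * u by rewrite addrC addKr.
have bq : 0 < complex.Re ((q.[s] * b.[s0]) / (q.[s0] * b.[s])).
  have : 0 < psi (complex.Re s, complex.Im s).
    apply: dpsi; rewrite /z0; split; rewrite /ball /= distrC.
      apply: le_lt_trans (lt_le_trans epsu _); last by rewrite ge_min lexx.
      rewrite -ds; apply: le_trans (Re_le_normc _).
      by case: (s) (s0) => [? ?] [? ?].
    apply: le_lt_trans (lt_le_trans epsu _); last by rewrite ge_min lexx.
    rewrite -ds; apply: le_trans (Im_le_normc _).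
    by case: (s) (s0) => [? ?] [? ?].
  rewrite /psi; have -> : cpx (complex.Re s, complex.Im s) = s by case: (s).
  rewrite !hornerM !hornerC => psi_s; rewrite Re_div divr_gt0 //.
  rewrite exprn_gt0 // normc_gt0; apply: contraTneq psi_s => ->.
  by rewrite conjc0 mulr0 /= ltxx.
have bs : b.[s] != 0.
  by apply: contraTneq bq => ->; rewrite mulr0 invr0 mulr0 /= ltxx.
split=> //.
  by rewrite ds (lt_le_trans epsu) // ge_min lexx orbT.
have fE : a.[s] / b.[s] = c * (1 + toC (eps ^+ k) * ((q.[s] * b.[s0]) / (q.[s0] * b.[s]))).
  have : a.[s] = c * b.[s] + q.[s] * (toC eps * u) ^+ k.
    have := congr1 (horner^~ s) QE.
    rewrite hornerD hornerN hornerZ hornerM horner_exp hornerXsubC ds => <-.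
    by rewrite addrC subrK.
  rewrite exprMn uE -rmorphXn => ->; field.
  by rewrite c0 b0 bs q0.
rewrite fE [X in _ < X]normcM ltr_pMr ?normc_gt0 //.
apply: lt_le_trans (Re_le_normc _); apply: lt_le_trans (ler_norm _).
set w := (_ / _); have -> : complex.Re (1 + toC (eps ^+ k) * w) =
  1 + eps ^+ k * complex.Re w by case: (w) => x y /=; ring.
by rewrite ltrDl mulr_gt0 // exprn_gt0.
Qed.


(** A value above [gamma] forces, by the decay at infinity, the modulus to have a
    maximum on a compact rectangle, away from the imaginary axis and from the
    other sides; there it would be a local maximum. *)
Theorem halfplane_maximum_modulus a b (gamma M : R) :
  (forall s, 0 <= complex.Re s -> b.[s] != 0) ->
  (forall s, 0 <= complex.Re s -> normc (a.[s] / b.[s]) * (1 + normc s) <= M) ->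
  (forall w, normc (a.[jw w] / b.[jw w]) <= gamma) ->
  forall s, 0 <= complex.Re s -> normc (a.[s] / b.[s]) <= gamma.
Proof.
move=> b0 fM fg s0 s00; rewrite leNgt; apply/negP => gs0.
pose f s := normc (a.[s] / b.[s]).
have {}fM s : 0 <= complex.Re s -> f s * (1 + normc s) <= M by exact: fM.
have {}fg w : f (jw w) <= gamma by exact: fg.
rewrite -/(f s0) in gs0.
have g0 : 0 <= gamma by apply: le_trans (fg 0); exact: normc_ge0.
have fs0 : 0 < f s0 by lra.
(* By the decay, [f] is smaller than at [s0] from this distance on. *)
pose rho := M / f s0.
have inside s : 0 <= complex.Re s -> f s0 <= f s -> normc s < rho.
  move=> sge fle; rewrite /rho ltr_pdivlMr //.
  have n0 := normc_ge0 s; have := fM _ sge; rewrite -/(f s).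
  have : f s0 * (1 + normc s) <= f s * (1 + normc s) by rewrite ler_wpM2r //; lra.
  by lra.
pose K : set (R * R) := (`[0, rho] `*` `[- rho, rho])%classic.
pose phi (z : R * R) := f (cpx z).
have inK s : 0 <= complex.Re s -> normc s <= rho -> K (complex.Re s, complex.Im s).
  move=> sge sr; have := Re_le_normc s; have := Im_le_normc s.
  rewrite !ler_norml => /andP[h1 h2] /andP[h3 h4].
  by split; rewrite /= in_itv /=; apply/andP; split; lra.
have cK : compact K by apply: compact_setX; exact: segment_compact.
have cpxE s : cpx (complex.Re s, complex.Im s) = s by case: s.
have cphi : ({within K, continuous phi})%classic.
  apply: continuous_in_subspaceT => z; rewrite inE => -[/= zx _].
  have {zx} z0 : 0 <= complex.Re (cpx z) by move: zx; rewrite in_itv => /andP[].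
  have phiE : phi = (fun z : R * R =>
      Num.sqrt (complex.Re a.[cpx z] ^+ 2 + complex.Im a.[cpx z] ^+ 2) *
      (Num.sqrt (complex.Re b.[cpx z] ^+ 2 + complex.Im b.[cpx z] ^+ 2))^-1).
    apply/funext => y; rewrite /phi /f normcM normcV -!sqr_normc_ReIm.
    by rewrite !sqrtr_sqr !ger0_norm ?normc_ge0.
  have [a1 a2] := continuous_horner_cpx a; have [b1 b2] := continuous_horner_cpx b.
  have sq (g h : R * R -> R) : continuous g -> continuous h ->
      {for z, continuous (fun z : R * R => Num.sqrt (g z ^+ 2 + h z ^+ 2))}.
    move=> cg ch; have cgh : {for z, continuous (fun z : R * R => g z ^+ 2 + h z ^+ 2)}.
      by apply: cvgD; apply: cvgM; solve [exact: cg|exact: ch].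
    exact: (continuous_comp cgh (@sqrt_continuous R _)).
  rewrite phiE; apply: cvgM; first exact: (sq _ _ a1 a2).
  apply: cvgV; last exact: (sq _ _ b1 b2).
  rewrite -sqr_normc_ReIm sqrtr_sqr ger0_norm ?normc_ge0 //.
  by rewrite gt_eqF // normc_gt0 b0.
have ne : (K !=set0)%classic.
  by exists (complex.Re s0, complex.Im s0); apply: inK => //; exact/ltW/inside.
have [z1 z1K z1max] := compact_EVT_max ne cK cphi.
set s1 := cpx z1.
have s1ge : 0 <= complex.Re s1.
  by move: z1K; rewrite inE => -[/=]; rewrite in_itv => /andP[].
have s1max s : 0 <= complex.Re s -> f s <= f s1.
  move=> sge; have [fs|/ltW fs] := leP (f s) (f s0); last first.
    have := z1max (complex.Re s, complex.Im s); rewrite inE /phi cpxE; apply.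
    by apply: inK => //; exact/ltW/inside.
  apply: le_trans fs _; have := z1max (complex.Re s0, complex.Im s0).
  by rewrite inE /phi cpxE; apply; apply: inK => //; exact/ltW/inside.
have fs1 : 0 < f s1 by apply: lt_le_trans (s1max _ s00).
have s1gt : 0 < complex.Re s1.
  rewrite lt_neqAle s1ge andbT; apply/eqP => e.
  have : f s1 <= gamma by rewrite /s1 /cpx -[z1.1]/(complex.Re s1) -e; exact: fg.
  by have := s1max _ s00; lra.
have as1 : a.[s1] != 0.
  by apply: contraTneq fs1 => as1; rewrite /f as1 mul0r normc0 ltxx.
have nconst : a != (a.[s1] / b.[s1]) *: b.
  apply/eqP => e; have := fg 0; rewrite -/(f _).
  have -> : f (jw 0) = f s1.
    by rewrite /f {1}e hornerZ mulfK // b0.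
  by have := s1max _ s00; lra.
have [s [ss1 bs fs]] := rational_no_local_max (b0 _ s1ge) as1 nconst s1gt.
have : f s <= f s1.
  apply: s1max; have := Re_le_normc (s - s1); rewrite ler_norml => /andP[h _].
  have : complex.Re s = complex.Re (s - s1) + complex.Re s1.
    by case: (s) (s1) => [? ?] [? ?] /=; rewrite subrK.
  by move: ss1 h; set r := complex.Re (s - s1); lra.
by rewrite leNgt fs.
Qed.

End Modulus.

(** * The small-gain theorem *)

Section SmallGain.
Variable R : realType.
Local Notation C := R[i].
Local Notation toC := (real_complex R).

Lemma fnorm_le_sum n m (A : 'M[C]_(n, m)) :
  fnorm A <= \sum_i \sum_j normc (A i j).
Proof.
rewrite pair_bigA /=; set S := \sum_p _.
have S0 : 0 <= S by apply: sumr_ge0 => p _; exact: normc_ge0.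
rewrite -(@ler_pXn2r _ 2) ?nnegrE ?fnorm_ge0 // sqr_fnorm fdotE pair_bigA /=.
rewrite [X in _ <= X]expr2 {1}/S mulr_suml; apply: ler_sum => p _.
rewrite Re_conjM -sqr_normc_ReIm expr2 ler_wpM2l ?normc_ge0 //.
by rewrite /S (bigD1 p) //= lerDl; apply: sumr_ge0 => q _; exact: normc_ge0.
Qed.

Lemma fnorm11 (A : 'M[C]_1) : fnorm A = normc (A 0 0).
Proof.
rewrite /fnorm fdotE !big_ord1 Re_conjM -sqr_normc_ReIm sqrtr_sqr ger0_norm //.
exact: normc_ge0.
Qed.

Lemma fnormM n m k (A : 'M[C]_(n, m)) (B : 'M[C]_(m, k)) :
  fnorm (A *m B) <= fnorm A * fnorm B.
Proof.
apply: le_trans (fnorm_mul_sigma _ _) _.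
by rewrite ler_wpM2r ?fnorm_ge0 // sigma_max_le_fnorm.
Qed.

(** All poles lie in the open left half-plane. *)
Definition stable_tfm p m (F : tfm R p m) : Prop :=
  forall s, 0 <= complex.Re s -> regular F s.

(** Together with stability this is strict properness, in the quantitative form
    that the maximum modulus principle needs. *)
Definition decaying p m (F : tfm R p m) : Prop :=
  exists M : R, forall s, 0 <= complex.Re s ->
    fnorm (tfm_at F s) * (1 + normc s) <= M.

Lemma stable_tfmM p m q (F : tfm R p m) (G : tfm R m q) :
  stable_tfm F -> stable_tfm G -> stable_tfm (F *m G).
Proof. by move=> sF sG s s0; exact: regularM (sF s s0) (sG s s0). Qed.

Lemma stable_tfmD p m (F G : tfm R p m) :
  stable_tfm F -> stable_tfm G -> stable_tfm (F + G).
Proof. by move=> sF sG s s0; exact: regularD (sF s s0) (sG s s0). Qed.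

Lemma stable_tfmB p m (F G : tfm R p m) :
  stable_tfm F -> stable_tfm G -> stable_tfm (F - G).
Proof. by move=> sF sG s s0; exact: regularB (sF s s0) (sG s s0). Qed.

Lemma stable_tfm1 n : stable_tfm (1%:M : tfm R n n).
Proof. by move=> s _; exists 1%:M; exact: has_values1. Qed.

Lemma stable_tfm_sum p m (I : finType) (A : pred I) (F : I -> tfm R p m) :
  (forall i, A i -> stable_tfm (F i)) -> stable_tfm (\sum_(i | A i) F i).
Proof.
move=> sF; elim/big_ind: _ => [s _||i Ai]; first exact: regular0.
  by move=> F1 F2; exact: stable_tfmD.
exact: sF.
Qed.

Lemma tfm_atM p m q (F : tfm R p m) (G : tfm R m q) s :
  regular F s -> regular G s -> tfm_at (F *m G) s = tfm_at F s *m tfm_at G s.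
Proof.
move=> /regular_has_values hF /regular_has_values hG.
exact/tfm_at_has_values/has_valuesM.
Qed.

Lemma tfm_atD p m (F G : tfm R p m) s :
  regular F s -> regular G s -> tfm_at (F + G) s = tfm_at F s + tfm_at G s.
Proof.
move=> /regular_has_values hF /regular_has_values hG.
exact/tfm_at_has_values/has_valuesD.
Qed.

Lemma tfm_atB p m (F G : tfm R p m) s :
  regular F s -> regular G s -> tfm_at (F - G) s = tfm_at F s - tfm_at G s.
Proof.
move=> /regular_has_values hF /regular_has_values hG.
exact/tfm_at_has_values/has_valuesB.
Qed.

Lemma tfm_at1 n s : tfm_at (1%:M : tfm R n n) s = 1%:M.
Proof. exact/tfm_at_has_values/has_values1. Qed.

Lemma decayingD p m (F G : tfm R p m) : stable_tfm F -> stable_tfm G ->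
  decaying F -> decaying G -> decaying (F + G).
Proof.
move=> sF sG [M FM] [N GN]; exists (M + N) => s s0.
rewrite tfm_atD; [|exact: sF|exact: sG].
have n0 := normc_ge0 s; apply: le_trans (lerD (FM s s0) (GN s s0)).
by rewrite -mulrDl ler_wpM2r ?fnormD //; lra.
Qed.

Lemma decayingM p m q (F : tfm R p m) (G : tfm R m q) :
  stable_tfm F -> stable_tfm G -> decaying F -> decaying G -> decaying (F *m G).
Proof.
move=> sF sG [M FM] [N GN]; exists (M * N) => s s0.
rewrite tfm_atM; [|exact: sF|exact: sG].
have n0 := normc_ge0 s; have f0 := fnorm_ge0 (tfm_at F s).
have g0 := fnorm_ge0 (tfm_at G s).
apply: le_trans (_ : fnorm (tfm_at F s) * (fnorm (tfm_at G s) * (1 + normc s)) <= _).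
  by rewrite mulrA ler_wpM2r ?fnormM //; lra.
apply: ler_pM => //; first by rewrite mulr_ge0 //; lra.
  apply: le_trans (FM s s0); rewrite ler_peMr //; lra.
exact: GN.
Qed.

Lemma decaying_sum p m (I : finType) (A : pred I) (F : I -> tfm R p m) :
  (forall i, A i -> stable_tfm (F i) /\ decaying (F i)) ->
  decaying (\sum_(i | A i) F i).
Proof.
move=> sF; suff [] : stable_tfm (\sum_(i | A i) F i) /\ decaying (\sum_(i | A i) F i).
  by [].
elim/big_ind: _ => [|G H [sG dG] [sH dH]|i Ai]; last exact: sF; last first.
  by split; [exact: stable_tfmD|exact: decayingD].
split=> [s _|]; first exact: regular0.
exists 0 => s _; rewrite (_ : tfm_at 0 s = 0).
  by rewrite /fnorm /fdot mulmx0 linear0 sqrtr0 mul0r.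
by apply/tfm_at_has_values => i j; rewrite !mxE; exact: has_value0.
Qed.

Lemma size_adj_char_poly_mx n (A : 'M[C]_n) i j :
  (size (\adj (char_poly_mx A) i j) <= n)%N.
Proof.
case: n A i j => [A []//|n A i j]; rewrite mxE /cofactor size_Msign.
apply: leq_trans (size_sum _ _ _) _; apply/bigmax_leqP => t _.
rewrite size_Msign; apply: leq_trans (size_poly_prod_leq _ _) _.
rewrite card_ord leq_subLR addnS ltnS.
apply: (@leq_trans (\sum_(k < n) 2)); last by rewrite sum_nat_const card_ord muln2 addnn.
apply: leq_sum => k _; rewrite !mxE; case: eqP => _.
  by rewrite mulr1n size_XsubC.
by rewrite mulr0n sub0r size_polyN (leq_trans (size_polyC_leq1 _)).
Qed.

Lemma size_numerator n m p (S : system C n m p) i j :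
  (size (numerator S i j) < size (char_poly (sysA S)))%N.
Proof.
rewrite size_char_poly ltnS mxE.
apply: leq_trans (size_sum _ _ _) _; apply/bigmax_leqP => k _.
rewrite !mxE mulrC mul_polyC; apply: leq_trans (size_scale_leq _ _) _.
apply: leq_trans (size_sum _ _ _) _; apply/bigmax_leqP => l _.
rewrite mxE mul_polyC; apply: leq_trans (size_scale_leq _ _) _.
exact: size_adj_char_poly_mx.
Qed.

Lemma stable_transfer n m p (S : system C n m p) :
  stable_mx (sysA S) -> stable_tfm (transfer S).
Proof. by move=> sA s /sA; exact: regular_transfer. Qed.

Lemma decaying_transfer n m p (S : system C n m p) :
  stable_mx (sysA S) -> decaying (transfer S).
Proof.
move=> sA; have /choice[M MP] : forall ij : 'I_p * 'I_m, exists M : R,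
    forall s, 0 <= complex.Re s ->
      normc (tfm_at (transfer S) s ij.1 ij.2) * (1 + normc s) <= M.
  move=> [i j] /=; have [M _ dM] := strictly_proper_decay (size_numerator S i j) sA.
  exists M => s s0; rewrite mxE; suff -> : rateval (transfer S i j) s =
    (numerator S i j).[s] / (char_poly (sysA S)).[s] by exact: dM.
  apply: rateval_has_value; exists (numerator S i j), (char_poly (sysA S)); split=> //.
  - exact: sA.
  - exact: transfer_numerator.
exists (\sum_ij M ij) => s s0; have n0 := normc_ge0 s.
apply: le_trans (_ : (\sum_i \sum_j normc (tfm_at (transfer S) s i j)) * (1 + normc s)
  <= _); first by rewrite ler_wpM2r ?fnorm_le_sum //; lra.
rewrite pair_bigA mulr_suml; apply: ler_sum => ij _; exact: MP.
Qed.

(** If [1 + F] is singular at [s] with null vector [v], then the scalar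
    [v^* F v] has modulus [|v|^2] at [s], although on the imaginary axis it stays
    below [gamma |v|^2]: this contradicts the maximum modulus principle. *)
Theorem small_gain p (F : tfm R p p) (gamma : R) :
  stable_tfm F -> decaying F -> gamma < 1 ->
  (forall w (V : 'cV[C]_p), fnorm (tfm_at F (jw w) *m V) <= gamma * fnorm V) ->
  forall s, 0 <= complex.Re s -> 1%:M + tfm_at F s \in unitmx.
Proof.
move=> sF [M dM] g1 Fg s s0; apply/contraT => nu.
have [v v0 ve] : exists2 v : 'cV[C]_p, v != 0 & tfm_at F s *m v = - v.
  have : \det (1%:M + tfm_at F s)^T == 0.
    by rewrite det_tr; move: nu; rewrite unitmxE unitfE negbK.
  move=> /det0P[u u0 ue]; exists u^T; first by rewrite trmx_eq0.
  apply/eqP; rewrite -addr_eq0 addrC -{1}[u^T]mul1mx -mulmxDl.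
  by rewrite -[1%:M + _]trmxK -trmx_mul ue trmx0.
pose f := (cst_tfm (ctr v) *m F *m cst_tfm v) 0 0.
pose fv t := (ctr v *m tfm_at F t *m v) 0 0.
have fP t : 0 <= complex.Re t -> has_value f t (fv t).
  move=> t0; have := has_valuesM (has_valuesM (has_values_cst (ctr v) t)
    (regular_has_values (sF t t0))) (has_values_cst v t); exact.
have [a [b [b0 fE]]] : exists a b, [/\ forall s, 0 <= complex.Re s -> b.[s] != 0 &
    f = tofrac a / tofrac b].
  by apply: regular_represented => t t0; exists (fv t); exact: fP.
have ab t : 0 <= complex.Re t -> a.[t] / b.[t] = fv t.
  by move=> t0; apply: has_value_uniq (fP t t0); exists a, b; split=> //; exact: b0.
have v_gt0 : 0 < fnorm v.
  by rewrite lt_neqAle fnorm_ge0 andbT eq_sym; apply: contra_neq v0 => /fnorm_eq0.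
have fvE t : normc (fv t) = fnorm (ctr v *m (tfm_at F t *m v)).
  by rewrite fnorm11 mulmxA.
have fv_le t : normc (fv t) <= fnorm v * fnorm (tfm_at F t *m v).
  by rewrite fvE (le_trans (fnormM _ _)) // fnorm_ctr.
have := @halfplane_maximum_modulus R a b (gamma * fnorm v ^+ 2) (M * fnorm v ^+ 2) b0.
case/(_ _ _ s s0)/Wrap => [t t0|w|].
- rewrite ab //; have n0 := normc_ge0 t.
  apply: le_trans (_ : fnorm (tfm_at F t) * (1 + normc t) * fnorm v ^+ 2 <= _).
    rewrite mulrAC ler_wpM2r //; first lra.
    apply: le_trans (fv_le t) _; rewrite expr2 mulrA mulrC.
    by rewrite ler_wpM2r ?fnorm_ge0 // fnormM.
  by rewrite ler_wpM2r ?exprn_ge0 ?fnorm_ge0 // dM.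
- rewrite ab //=; apply: le_trans (fv_le _) _.
  by rewrite expr2 mulrCA ler_wpM2l ?fnorm_ge0.
- rewrite ab // fvE ve mulmxN fnormN fnorm11.
  have -> : (ctr v *m v) 0 0 = toC (fnorm v ^+ 2).
    by rewrite sqr_fnorm -tr_ctr_mul trace_mx11.
  rewrite /= expr0n addr0 sqrtr_sqr ger0_norm ?exprn_ge0 ?fnorm_ge0 //.
  by rewrite leNgt gtr_pMl ?g1 // exprn_gt0.
Qed.

End SmallGain.

(** * Perturbation of the controller in a loop *)

Section LoopPerturbation.
Variable F : fieldType.
Variables (p m : nat) (G : 'M[F]_(p, m)) (K D : 'M[F]_(m, p)).
Hypothesis uGK : 1%:M - G *m K \in unitmx.
Let Y := invmx (1%:M - G *m K).
Let X := Y *m G.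
Hypothesis uXD : 1%:M + X *m D \in unitmx.
Let W := invmx (1%:M + X *m D).
Let Kr := K - D.
Let Yr := invmx (1%:M - G *m Kr).

(** [1 - G Kr = (1 - G K) (1 + X D)]. *)
Lemma perturbed_Y : Yr = W *m Y.
Proof.
have e : (1%:M - G *m Kr) *m (W *m Y) = 1%:M.
  have -> : 1%:M - G *m Kr = (1%:M - G *m K) *m (1%:M + X *m D).
    rewrite [RHS]mulmxDr mulmx1 /X !mulmxA mulmxV // mul1mx.
    by rewrite mulmxBr opprB addrA addrAC.
  by rewrite -mulmxA (mulmxA _ W) mulmxV // mul1mx mulmxV.
by have [u _] := mulmx1_unit e; rewrite -[RHS](mulKmx u) e mulmx1.
Qed.

Lemma perturbed_X : Yr *m G = W *m X.
Proof. by rewrite perturbed_Y mulmxA. Qed.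

Lemma perturbed_XK : Yr *m G *m Kr = W *m (X *m K - X *m D).
Proof. by rewrite perturbed_X -mulmxA mulmxBr. Qed.

Let KW : K *m W = K - K *m X *m D *m W.
Proof.
have -> : K *m X *m D *m W = K *m (X *m D *m W) by rewrite !mulmxA.
rewrite -{2}(mulmx1 K) -mulmxBr; congr (_ *m _).
by rewrite -(mulmxV uXD) -/W mulmxDl mul1mx addrK.
Qed.

(** [K] itself may have poles on the imaginary axis or to its right. Writing
    [K W = K - K X D W] leaves only [K X] and [K Z], which are stable. *)
Lemma perturbed_K q (Z : 'M[F]_(p, q)) :
  Kr *m (W *m Z) = K *m Z - (K *m X + 1%:M) *m (D *m (W *m Z)).
Proof.
rewrite mulmxBl (mulmxA K) KW mulmxBl mulmxDl mul1mx opprD addrA.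
by rewrite !mulmxA.
Qed.

End LoopPerturbation.

(** * Modal truncation and internal stability *)

Section Stabilization.
Variable R : realType.
Local Notation C := R[i].
Local Notation toC := (real_complex R).

Lemma root_char_poly n (A : 'M[C]_n) s :
  root (char_poly A) s = (s%:M - A \notin unitmx).
Proof.
have e : map_mx (horner_eval s) (char_poly_mx A) = s%:M - A.
  apply/matrixP => i j; rewrite !mxE /horner_eval hornerD hornerN hornerC.
  by rewrite hornerMn hornerX.
by rewrite rootE unitmxE unitfE negbK -e det_map_mx.
Qed.

Lemma stable_mx_similar n n' m p (S : system C n m p) (S' : system C n' m p) :
  Defs.similar S S' -> stable_mx (sysA S) -> stable_mx (sysA S').
Proof.
move=> [T [Ti [e1 e2 <-]]] sA s /sA; rewrite !root_char_poly !negbK /= => u.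
have -> : s%:M - T *m sysA S *m Ti = T *m (s%:M - sysA S) *m Ti.
  by rewrite mulmxBr mulmxBl scalar_mxC -!mulmxA e1 mulmx1.
suff e : T *m (s%:M - sysA S) *m Ti *m
    (T *m (invmx (s%:M - sysA S) *m Ti)) = 1%:M by case: (mulmx1_unit e).
by rewrite mulmxA -(mulmxA _ Ti) e2 mulmx1 -mulmxA (mulmxA _ _ Ti) mulmxV // mul1mx.
Qed.

(** A diagonal block of an inverse of [diag (s - A_i)] inverts [s - A_i]. *)
Lemma stable_mx_mxdiag k (sz : 'I_k -> nat) (A : forall i, 'M[C]_(sz i)) :
  stable_mx (\mxdiag_i A i) -> forall i, stable_mx (A i).
Proof.
move=> sA i s /sA; rewrite !root_char_poly !negbK => u.
have := mulmxV u; set Z := invmx _.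
rewrite -!mxdiagZ -mxdiagB -[Z]submxblockK mul_mxdiag_mxblock.
move=> /(congr1 (fun M => submxblock M i i)); rewrite mxblockK submxblock_diag.
by move=> /mulmx1_unit[].
Qed.

Definition realizable m p (F : tfm R p m) : Prop :=
  exists n (S : system C n m p), transfer S = F.

Lemma realizableD m p (F G : tfm R p m) :
  realizable F -> realizable G -> realizable (F + G).
Proof.
move=> [n [S <-]] [k [T <-]]; exists (n + k)%N, (parallel S T).
exact: transfer_parallel.
Qed.

Lemma realizable_sum m p (I : finType) (A : pred I) (F : I -> tfm R p m) :
  (forall i, realizable (F i)) -> realizable (\sum_(i | A i) F i).
Proof.
move=> rF; elim/big_ind: _ => [||i _]; [|exact: realizableD|exact: rF].
exists 0%N, (System 0 0 0); rewrite transferE /= !cst_tfm0.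
by rewrite mulmx0.
Qed.

Lemma complexify_similar n n' m p (S : system R n m p) (S' : system R n' m p) :
  Defs.similar S S' -> Defs.similar (complexify S) (complexify S').
Proof.
move=> [T [Ti [e1 e2 <-]]]; exists (map_mx toC T), (map_mx toC Ti).
by split; rewrite -?map_mxM ?e1 ?e2 ?map_mx1 // /complexify /= !map_mxM.
Qed.

Lemma complexify_parallel n1 n2 m p (S1 : system R n1 m p) (S2 : system R n2 m p) :
  complexify (parallel S1 S2) = parallel (complexify S1) (complexify S2).
Proof.
by rewrite /complexify /parallel /= map_block_mx map_col_mx map_row_mx !map_mx0.
Qed.

Lemma transfer_separation n n1 n2 m p (K : system R n m p)
    (Klt : system R n1 m p) (Kge : system R n2 m p) :
  stable_unstable_separation K Klt Kge -> transfer (complexify K) =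
    transfer (complexify Klt) + transfer (complexify Kge).
Proof.
move=> [/complexify_similar/transfer_similar -> _ _].
by rewrite complexify_parallel transfer_parallel.
Qed.

(** The error is a sum of transfer matrices of
    diagonal blocks of a matrix similar to a Hurwitz one. *)
Lemma modal_truncation_error n m p r (S : system R n m p) (F : tfm R p m) :
  hurwitz (sysA S) -> modal_truncation r S F ->
  [/\ realizable F, stable_tfm (transfer (complexify S) - F) &
    decaying (transfer (complexify S) - F)].
Proof.
move=> /hurwitzP hA [k [sz [a [blk [removed [_ sim _ _ ->]]]]]].
have sblk := @stable_mx_mxdiag _ sz (fun i => sysA (blk i)) (stable_mx_similar sim hA).
rewrite (transfer_similar sim) transfer_big_parallel.
have -> : \sum_i transfer (blk i) - \sum_(i | i \notin removed) transfer (blk i)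
  = \sum_(i | i \in removed) transfer (blk i).
  by rewrite (bigID (mem removed)) /= addrK.
split.
- by apply: realizable_sum => i; exists (sz i), (blk i).
- by apply: stable_tfm_sum => i _; exact: stable_transfer.
- apply: decaying_sum => i _; split; [exact: stable_transfer|exact: decaying_transfer].
Qed.

(** A complex realization, such as the truncated Jordan form, yields a minimal
    real one, for which stability of the four closed-loop transfer matrices is
    equivalent to the closed-loop matrix being Hurwitz. *)
Theorem internally_stabilizes_stable n m p (P : system R n m p) (K : tfm R m p) :
  minimal P -> realizable K -> real_rational K ->
  let G := transfer (complexify P) in
  stable_tfm (Xtf G K) -> stable_tfm (Xtf G K *m K) ->
  stable_tfm (K *m Xtf G K) -> stable_tfm (K *m Ytf G K) ->
  internally_stabilizes P K.
Proof.
move=> mP [k [Sc <-]] rK G sX sXK sKX sKY.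
have [S' S'E] := real_realization rK; have [q [S [mS SE]]] := minimal_realization S'.
exists q, S; split=> //; first by rewrite SE S'E.
apply: hurwitz_feedback => // s s0.
have [_ ->] := transfer_feedback (complexify P) (complexify S).
rewrite SE S'E; apply/regular_block.
by split; [exact: sX|exact: sXK|exact: sKX|exact: sKY].
Qed.

End Stabilization.

(** * The H2 norm as an L2 norm on the imaginary axis *)

Section HtwoNorm.
Variable R : realType.
Local Notation C := R[i].
Local Notation toC := (real_complex R).
Local Notation mu := (@lebesgue_measure R).

(** For [g w = |F (jw)|] this is the H2 norm of [F]. *)
Definition axis_l2 (g : R -> R) : \bar R :=
  sqrte ((2 * pi)^-1%:E * \int[mu]_(w in [set: R]) (g w ^+ 2)%:E)%E.

Definition axis_fnorm p m (F : tfm R p m) (w : R) : R := fnorm (tfm_at F (jw w)).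

Lemma axis_fnorm_ge0 p m (F : tfm R p m) w : 0 <= axis_fnorm F w.
Proof. exact: fnorm_ge0. Qed.

Let twopi0 : 0 <= (2 * pi)^-1 :> R.
Proof. by rewrite invr_ge0 mulr_ge0 // pi_ge0. Qed.

Lemma axis_l2_Lnorm (g : R -> R) :
  axis_l2 g = ((Num.sqrt (2 * pi)^-1)%:E * Lnorm mu 2%:E (EFin \o g))%E.
Proof.
rewrite /axis_l2 sqrteM ?lee_fin //; congr (_ * _)%E.
rewrite unlock /Lnorm -poweR12_sqrt; last first.
  by apply: integral_ge0 => w _; rewrite lee_fin sqr_ge0.
congr (_ `^ _)%E; apply: eq_integral => w _ /=.
by rewrite powR_mulrn ?normr_ge0 // real_normK ?num_real.
Qed.

Lemma axis_l2D (g h : R -> R) : measurable_fun [set: R] g ->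
  measurable_fun [set: R] h ->
  (axis_l2 (fun w => g w + h w)%R <= axis_l2 g + axis_l2 h)%E.
Proof.
move=> mg mh; rewrite !axis_l2_Lnorm -ge0_muleDr ?Lnorm_ge0 //.
rewrite lee_wpmul2l ?lee_fin ?sqrtr_ge0 //.
exact: (@minkowski_EFin _ _ _ mu g h 2 mg mh (ler1n _ _)).
Qed.

Lemma axis_l2Z (c : R) (g : R -> R) : measurable_fun [set: R] g -> 0 <= c ->
  axis_l2 (fun w => c * g w) = (c%:E * axis_l2 g)%E.
Proof.
move=> mg c0; rewrite /axis_l2.
have -> : (\int[mu]_(w in [set: R]) ((c * g w) ^+ 2)%:E =
    (c ^+ 2)%:E * \int[mu]_(w in [set: R]) (g w ^+ 2)%:E)%E.
  under eq_integral do rewrite exprMn EFinM.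
  rewrite ge0_integralZl_EFin ?sqr_ge0 //.
  - by move=> w _; rewrite lee_fin sqr_ge0.
  - by apply/measurable_EFinP; exact: measurable_funX.
rewrite muleCA sqrteM ?lee_fin ?sqr_ge0 //; congr (_ * _)%E.
by rewrite /= sqrtr_sqr ger0_norm.
Qed.

Lemma axis_l2_le (g h : R -> R) : measurable_fun [set: R] g ->
  measurable_fun [set: R] h -> (forall w, 0 <= g w <= h w) ->
  (axis_l2 g <= axis_l2 h)%E.
Proof.
move=> mg mh gh; rewrite /axis_l2 lee_sqrt; last first.
  rewrite mule_ge0 ?lee_fin //.
  by apply: integral_ge0 => w _; rewrite lee_fin sqr_ge0.
rewrite lee_wpmul2l ?lee_fin //; apply: ge0_le_integral => [//|w _||| w _].
- by rewrite lee_fin sqr_ge0.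
- by apply/measurable_EFinP; exact: measurable_funX.
- by apply/measurable_EFinP; exact: measurable_funX.
- rewrite lee_fin; have /andP[g0 gh'] := gh w.
  by rewrite ler_pXn2r ?nnegrE // (le_trans g0).
Qed.

Lemma continuous_sum_fun (I : Type) (r : seq I) (g : I -> R -> R) :
  (forall i, continuous (g i)) -> continuous (fun w => \sum_(i <- r) g i w).
Proof.
move=> cg; elim: r => [|i r IHr].
  by under eq_fun do rewrite big_nil; move=> x; exact: cvg_cst.
by under eq_fun do rewrite big_cons; move=> x; apply: cvgD; [exact: cg|exact: IHr].
Qed.

(** On the axis every entry is a quotient of polynomials with a denominator that
    does not vanish, hence continuous. *)
Lemma measurable_axis_fnorm p m (F : tfm R p m) :
  (forall w, regular F (jw w)) -> measurable_fun [set: R] (axis_fnorm F).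
Proof.
move=> rF; apply: continuous_measurable_fun => x0.
have cjw : continuous (fun w : R => (0, w) : R * R).
  by move=> x; exact: (cvg_pair (cvg_cst (0 : R)) cvg_id).
have cpoly (a : {poly C}) : continuous (fun w : R => normc a.[jw w] ^+ 2).
  have [cRe cIm] := continuous_horner_cpx a.
  have cRe' x := continuous_comp (cjw x) (cRe (0, x)).
  have cIm' x := continuous_comp (cjw x) (cIm (0, x)).
  under eq_fun do rewrite sqr_normc_ReIm.
  by move=> x; apply: cvgD; apply: cvgM; solve [exact: cRe'|exact: cIm'].
have centry i j : continuous (fun w : R => normc (tfm_at F (jw w) i j) ^+ 2).
  have [a [b [b0 fE]]] : exists a b, [/\ forall s, (exists w, s = jw w) -> b.[s] != 0 &
      F i j = tofrac a / tofrac b].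
    by apply: regular_represented => _ [x ->]; have [V FV] := rF x; exists (V i j).
  have {}b0 w : b.[jw w] != 0 by apply: b0; exists w.
  have -> : (fun w : R => normc (tfm_at F (jw w) i j) ^+ 2) =
      (fun w : R => normc a.[jw w] ^+ 2 * (normc b.[jw w] ^+ 2)^-1).
    apply/funext => w; rewrite mxE.
    rewrite (@rateval_has_value _ _ _ (a.[jw w] / b.[jw w])); last first.
      by exists a, b; split; [exact: b0|exact: fE|].
    by rewrite normcM normcV exprMn exprVn.
  move=> x; apply: cvgM; first exact: cpoly.
  by apply: cvgV; [rewrite expf_neq0 // gt_eqF // normc_gt0|exact: cpoly].
have gE : axis_fnorm F = (fun w : R =>
    Num.sqrt (\sum_i \sum_j normc (tfm_at F (jw w) i j) ^+ 2)).
  apply/funext => w; rewrite /axis_fnorm /fnorm fdotE; congr (Num.sqrt _).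
  apply: eq_bigr => i _; apply: eq_bigr => j _.
  by rewrite Re_conjM sqr_normc_ReIm.
have csum : continuous (fun w : R => \sum_i \sum_j normc (tfm_at F (jw w) i j) ^+ 2).
  by apply: continuous_sum_fun => i; apply: continuous_sum_fun => j; exact: centry.
rewrite gE; exact: (continuous_comp (csum x0) (@sqrt_continuous R _)).
Qed.

(** For a real rational matrix, [F (- jw)] is the conjugate of [F (jw)], so that
    the integrand of the H2 norm is the squared Frobenius norm. *)
Lemma h2norm_axis_fnorm p m (F : tfm R p m) : real_rational F ->
  (forall w, regular F (jw w)) -> h2norm F = axis_l2 (axis_fnorm F).
Proof.
move=> rrF rF; rewrite /h2norm /axis_l2; congr (sqrte (_ * _)%E).
apply: eq_integral => w _; congr (_%:E).
have -> : tfm_at F (- jw w) = map_mx Num.conj (tfm_at F (jw w)).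
  have -> : - jw w = conjc (jw w) by apply/eqP; rewrite eq_complex /= oppr0 !eqxx.
  apply: tfm_at_has_values => i j; rewrite mxE; have [a [b [b0 fE]]] := rrF i j.
  exact: has_value_conj b0 fE (regular_has_values (rF w) i j).
by rewrite /axis_fnorm sqr_fnorm.
Qed.

End HtwoNorm.

(** * Norm estimates for the perturbed loop *)

Section HinfBounds.
Variable R : realType.
Local Notation C := R[i].
Local Notation toC := (real_complex R).

Lemma sigma_max_hinfnorm p m (F : tfm R p m) w :
  ((sigma_max (tfm_at F (jw w)))%:E <= hinfnorm F)%E.
Proof. by apply: ereal_sup_ubound; exists w. Qed.

Lemma hinfnorm_ge0 p m (F : tfm R p m) : (0 <= hinfnorm F)%E.
Proof.
by apply: le_trans (sigma_max_hinfnorm F 0); rewrite lee_fin sigma_max_ge0.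
Qed.

Lemma hinfnorm_bounded p m (F : tfm R p m) (M : R) :
  (forall w, axis_fnorm F w <= M) -> exists2 c : R, 0 <= c & hinfnorm F = c%:E.
Proof.
move=> FM; have h0 := hinfnorm_ge0 F.
have : (hinfnorm F <= M%:E)%E.
  apply: ge_ereal_sup => _ [w _ <-]; rewrite lee_fin.
  exact: le_trans (sigma_max_le_fnorm _) (FM w).
by case: (hinfnorm F) h0 => // c c0 _; exists c.
Qed.

Lemma decaying_bounded p m (F : tfm R p m) :
  decaying F -> exists M, forall w, axis_fnorm F w <= M.
Proof.
move=> [M FM]; exists M => w; have n0 := normc_ge0 (jw w).
have := FM (jw w) (lexx _); rewrite -/(axis_fnorm F w); apply: le_trans.
by rewrite ler_peMr ?axis_fnorm_ge0 //; lra.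
Qed.

Lemma sigma_max_le_hinfnorm p m (F : tfm R p m) (c : R) w :
  hinfnorm F = c%:E -> sigma_max (tfm_at F (jw w)) <= c.
Proof. by move=> Fc; rewrite -lee_fin -Fc sigma_max_hinfnorm. Qed.

End HinfBounds.

Section MatrixGains.
Variable R : realType.
Local Notation C := R[i].

Lemma fnorm_mul_le p m q (M : 'M[C]_(p, m)) (c : R) (V : 'M[C]_(m, q)) :
  sigma_max M <= c -> fnorm (M *m V) <= c * fnorm V.
Proof.
by move=> Mc; apply: le_trans (fnorm_mul_sigma _ _) _; rewrite ler_wpM2r ?fnorm_ge0.
Qed.

Lemma mul_fnorm_le p m q (M : 'M[C]_(p, m)) (c : R) (V : 'M[C]_(q, p)) :
  sigma_max M <= c -> fnorm (V *m M) <= c * fnorm V.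
Proof.
by move=> Mc; apply: le_trans (fnorm_sigma_mul _ _) _; rewrite ler_wpM2r ?fnorm_ge0.
Qed.

Variables (p m : nat) (X : 'M[C]_(p, m)) (D : 'M[C]_(m, p)) (W : 'M[C]_p) (x d : R).
Hypotheses (Xx : sigma_max X <= x) (Dd : sigma_max D <= d) (xd1 : x * d < 1).
Hypothesis W1 : W *m (1%:M + X *m D) = 1%:M.

Let x0 : 0 <= x. Proof. exact: le_trans (sigma_max_ge0 _) Xx. Qed.
Let d0 : 0 <= d. Proof. exact: le_trans (sigma_max_ge0 _) Dd. Qed.
Let xd_gt0 : 0 < 1 - x * d. Proof. by rewrite subr_gt0. Qed.

(** [V = W V + X D W V], and the last term has norm at most [x d |W V|]. *)
Lemma fnorm_sensitivity_mul q (V : 'M[C]_(p, q)) :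
  fnorm (W *m V) <= (1 - x * d)^-1 * fnorm V.
Proof.
have e : (1%:M + X *m D) *m W = 1%:M by exact: mulmx1C.
rewrite mulrC ler_pdivlMr //; set Z := W *m V.
have VE : V = Z + X *m (D *m Z) by rewrite -[LHS]mul1mx -e -mulmxA mulmxDl mul1mx !mulmxA.
have h1 : fnorm Z <= fnorm V + fnorm (X *m (D *m Z)).
  have ZV : Z = V - X *m (D *m Z) by rewrite {1}VE addrK.
  by rewrite {1}ZV; apply: le_trans (fnormD _ _) _; rewrite fnormN.
have h2 : fnorm (X *m (D *m Z)) <= x * (d * fnorm Z).
  exact: (le_trans (fnorm_mul_le _ Xx) (ler_wpM2l x0 (fnorm_mul_le _ Dd))).
move: h1 h2; move: (fnorm Z) (fnorm V) (fnorm _) => a b c; lra.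
Qed.

(** The same with [V = V W + V W X D]. *)
Lemma mul_fnorm_sensitivity q (V : 'M[C]_(q, p)) :
  fnorm (V *m W) <= (1 - x * d)^-1 * fnorm V.
Proof.
rewrite mulrC ler_pdivlMr //; set Z := V *m W.
have VE : V = Z + Z *m X *m D by rewrite -[LHS]mulmx1 -W1 mulmxA mulmxDr mulmx1 !mulmxA.
have h1 : fnorm Z <= fnorm V + fnorm (Z *m X *m D).
  have ZV : Z = V - Z *m X *m D by rewrite {1}VE addrK.
  by rewrite {1}ZV; apply: le_trans (fnormD _ _) _; rewrite fnormN.
have h2 : fnorm (Z *m X *m D) <= d * (x * fnorm Z).
  exact: (le_trans (mul_fnorm_le _ Dd) (ler_wpM2l d0 (mul_fnorm_le _ Xx))).
move: h1 h2; move: (fnorm Z) (fnorm V) (fnorm _) => a b c; lra.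
Qed.

Let th0 : 0 <= (1 - x * d)^-1. Proof. by rewrite invr_ge0 ltW. Qed.

Let th_ge1 : 1 <= (1 - x * d)^-1.
Proof. by rewrite invf_ge1 //; have := mulr_ge0 x0 d0; lra. Qed.

Lemma fnorm_perturbed_output (N : 'M[C]_p) :
  fnorm (W *m (N - X *m D)) <= (1 - x * d)^-1 * (fnorm N + d * fnorm X).
Proof.
apply: le_trans (fnorm_sensitivity_mul _) _; apply: ler_wpM2l th0 _ _ _.
apply: le_trans (fnormD _ _) _; rewrite fnormN lerD2l; exact: mul_fnorm_le.
Qed.

Lemma fnorm_perturbed_input q (KX : 'M[C]_m) (Z : 'M[C]_(p, q)) (N : 'M[C]_(m, q))
    (k z : R) : sigma_max KX <= k -> sigma_max Z <= z ->
  fnorm (N - (KX + 1%:M) *m (D *m (W *m Z))) <=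
    (1 - x * d)^-1 * (fnorm N + (1 + k) * z * fnorm D).
Proof.
move=> KXk Zz; have k0 : 0 <= k by exact: le_trans (sigma_max_ge0 _) KXk.
have z0 : 0 <= z by exact: le_trans (sigma_max_ge0 _) Zz.
apply: le_trans (fnormD _ _) _; rewrite fnormN mulrDr; apply: lerD.
  by rewrite ler_peMl ?fnorm_ge0.
set V := D *m (W *m Z).
have VD : fnorm V <= z * ((1 - x * d)^-1 * fnorm D).
  rewrite /V mulmxA; apply: le_trans (mul_fnorm_le _ Zz) _.
  exact: (ler_wpM2l z0 (mul_fnorm_sensitivity _)).
have h : fnorm ((KX + 1%:M) *m V) <= (1 + k) * fnorm V.
  rewrite mulmxDl mul1mx; apply: le_trans (fnormD _ _) _.
  rewrite mulrDl mul1r addrC lerD2l; exact: fnorm_mul_le.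
apply: le_trans h _; rewrite [leRHS]mulrCA -mulrA; apply: ler_wpM2l VD; exact: addr_ge0.
Qed.

End MatrixGains.

Section EvaluatedGains.
Variable R : realType.
Variables (p m : nat) (X : tfm R p m) (D : tfm R m p) (W : tfm R p p) (x d : R).
Hypotheses (Xx : forall w, sigma_max (tfm_at X (jw w)) <= x)
  (Dd : forall w, sigma_max (tfm_at D (jw w)) <= d) (xd1 : x * d < 1).
Hypotheses (sX : stable_tfm X) (sD : stable_tfm D) (sW : stable_tfm W).
Hypothesis WE : forall w,
  tfm_at W (jw w) *m (1%:M + tfm_at X (jw w) *m tfm_at D (jw w)) = 1%:M.
Variable w : R.
Local Notation th := (1 - x * d)^-1.

Let w0 : 0 <= complex.Re (jw w). Proof. exact: lexx. Qed.

Lemma axis_fnorm_sensitivity_mul : axis_fnorm (W *m X) w <= th * axis_fnorm X w.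
Proof.
rewrite /axis_fnorm (tfm_atM (sW w0) (sX w0)).
exact (fnorm_sensitivity_mul (Xx w) (Dd w) xd1 (WE w) _).
Qed.

Lemma axis_fnorm_perturbed_output (N : tfm R p p) : stable_tfm N ->
  axis_fnorm (W *m (N - X *m D)) w <= th * (axis_fnorm N w + d * axis_fnorm X w).
Proof.
move=> sN; rewrite /axis_fnorm (tfm_atM (sW w0) (stable_tfmB sN (stable_tfmM sX sD) w0)).
rewrite (tfm_atB (sN _ w0) (stable_tfmM sX sD w0)) (tfm_atM (sX w0) (sD w0)).
exact (fnorm_perturbed_output (Xx w) (Dd w) xd1 (WE w) _).
Qed.

Lemma axis_fnorm_perturbed_input q (KX : tfm R m m) (Z : tfm R p q) (N : tfm R m q)
    (z k : R) : stable_tfm KX -> stable_tfm N -> stable_tfm Z ->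
  hinfnorm KX = k%:E -> hinfnorm Z = z%:E ->
  axis_fnorm (N - (KX + 1%:M) *m (D *m (W *m Z))) w <=
    th * (axis_fnorm N w + (1 + k) * z * axis_fnorm D w).
Proof.
move=> sKX sN sZ hKX hZ; have sKX1 := stable_tfmD sKX (@stable_tfm1 R m).
have sWZ := stable_tfmM sW sZ; have sDWZ := stable_tfmM sD sWZ.
rewrite /axis_fnorm (tfm_atB (sN _ w0) (stable_tfmM sKX1 sDWZ w0)).
rewrite (tfm_atM (sKX1 _ w0) (sDWZ _ w0)) (tfm_atM (sD w0) (sWZ _ w0)).
rewrite (tfm_atM (sW w0) (sZ _ w0)) (tfm_atD (sKX _ w0) (@stable_tfm1 _ _ _ w0)).
rewrite tfm_at1; exact (fnorm_perturbed_input (Xx w) (Dd w) xd1 (WE w) _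
  (sigma_max_le_hinfnorm w hKX) (sigma_max_le_hinfnorm w hZ)).
Qed.

End EvaluatedGains.

Section GainBounds.
Variable R : realType.
Variables (p m : nat) (G : tfm R p m) (K D : tfm R m p).
Hypothesis uGK : 1%:M - G *m K \in unitmx.
Let Y := Ytf G K.
Let X := Xtf G K.
Let Kr := K - D.
Hypotheses (sX : stable_tfm X) (sXK : stable_tfm (X *m K))
  (sKX : stable_tfm (K *m X)) (sKY : stable_tfm (K *m Y)) (sD : stable_tfm D)
  (dX : decaying X) (dD : decaying D).
Variables (x d : R).
Hypotheses (x0 : 0 <= x) (hX : hinfnorm X = x%:E)
  (hD : hinfnorm D = d%:E) (xd1 : x * d < 1).

Let W := invmx (1%:M + X *m D).

Let sXD : stable_tfm (X *m D). Proof. exact: stable_tfmM. Qed.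

(** [Y] is not strictly proper, but differs from [X K] by a constant only. *)
Lemma output_sensitivity : Y = 1%:M + X *m K.
Proof.
have e : Y *m (1%:M - G *m K) = 1%:M by rewrite /Y /Ytf mulVmx.
have {e} : Y = 1%:M + Y *m (G *m K) by rewrite -e mulmxBr mulmx1 subrK.
by rewrite mulmxA.
Qed.

Lemma stable_Y : stable_tfm Y.
Proof. by rewrite output_sensitivity; apply: stable_tfmD => //; exact: stable_tfm1. Qed.

Let Xx w : sigma_max (tfm_at X (jw w)) <= x.
Proof. exact: sigma_max_le_hinfnorm hX. Qed.

Let Dd w : sigma_max (tfm_at D (jw w)) <= d.
Proof. exact: sigma_max_le_hinfnorm hD. Qed.

(** The small-gain theorem is applied to the loop formed by [X] and [D]. *)
Let unit_at s : 0 <= complex.Re s -> 1%:M + tfm_at (X *m D) s \in unitmx.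
Proof.
apply: (@small_gain _ _ _ (x * d)) => //; first exact: decayingM.
move=> w V; rewrite tfm_atM; [|exact: sX|exact: sD].
rewrite -mulmxA -mulrA; apply: le_trans (fnorm_mul_le _ (Xx w)) _.
by rewrite ler_wpM2l // (fnorm_mul_le _ (Dd w)).
Qed.

Let inverse_at s : 0 <= complex.Re s -> 1%:M + X *m D \in unitmx /\
  has_values W s (invmx (1%:M + tfm_at (X *m D) s)).
Proof.
move=> s0; apply: has_values_inv (unit_at s0); apply: has_valuesD.
  exact: has_values1.
exact/regular_has_values/sXD.
Qed.

Let uXD : 1%:M + X *m D \in unitmx.
Proof. by have [] := @inverse_at 0 (lexx _). Qed.

Let sW : stable_tfm W.
Proof. by move=> s /inverse_at[_ WV]; eexists; exact: WV. Qed.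

Let Yr_E : Ytf G Kr = W *m Y.
Proof. exact (perturbed_Y uGK uXD). Qed.

Let Xr_E : Xtf G Kr = W *m X.
Proof. exact (perturbed_X uGK uXD). Qed.

Let XrKr_E : Xtf G Kr *m Kr = W *m (X *m K - X *m D).
Proof. exact (perturbed_XK uGK uXD). Qed.

Let KrXr_E : Kr *m Xtf G Kr = K *m X - (K *m X + 1%:M) *m (D *m (W *m X)).
Proof. rewrite Xr_E; exact (perturbed_K uXD X). Qed.

Let KrYr_E : Kr *m Ytf G Kr = K *m Y - (K *m X + 1%:M) *m (D *m (W *m Y)).
Proof. by rewrite Yr_E; exact (perturbed_K uXD Y). Qed.

Let sKX1 : stable_tfm (K *m X + 1%:M).
Proof. exact: stable_tfmD sKX (@stable_tfm1 _ _). Qed.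

Theorem perturbed_loop_stable :
  [/\ stable_tfm (Xtf G Kr), stable_tfm (Xtf G Kr *m Kr),
      stable_tfm (Kr *m Xtf G Kr) & stable_tfm (Kr *m Ytf G Kr)].
Proof.
split.
- by rewrite Xr_E; exact: stable_tfmM.
- by rewrite XrKr_E; apply: stable_tfmM sW (stable_tfmB sXK sXD).
- rewrite KrXr_E; apply: stable_tfmB sKX (stable_tfmM sKX1 (stable_tfmM sD _)).
  exact: stable_tfmM.
- rewrite KrYr_E; apply: stable_tfmB sKY (stable_tfmM sKX1 (stable_tfmM sD _)).
  exact: stable_tfmM sW stable_Y.
Qed.

Let WE w : tfm_at W (jw w) *m (1%:M + tfm_at X (jw w) *m tfm_at D (jw w)) = 1%:M.
Proof.
have w0 : 0 <= complex.Re (jw w) by [].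
have [_ WV] := inverse_at w0; rewrite -tfm_atM; [|exact: sX|exact: sD].
by rewrite (tfm_at_has_values WV) (mulVmx (unit_at w0)).
Qed.

Local Notation th := (1 - x * d)^-1.

Lemma axis_fnorm_Xr w : axis_fnorm (Xtf G Kr) w <= th * axis_fnorm X w.
Proof.
exact (eq_ind_r (fun F => axis_fnorm F w <= th * axis_fnorm X w)
  (axis_fnorm_sensitivity_mul Xx Dd xd1 sX sW WE w) Xr_E).
Qed.

Lemma axis_fnorm_XrKr w :
  axis_fnorm (Xtf G Kr *m Kr) w <=
    th * (axis_fnorm (X *m K) w + d * axis_fnorm X w).
Proof.
exact (eq_ind_r
  (fun F => axis_fnorm F w <= th * (axis_fnorm (X *m K) w + d * axis_fnorm X w))
  (axis_fnorm_perturbed_output Xx Dd xd1 sX sD sW WE w sXK) XrKr_E).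
Qed.

Lemma axis_fnorm_KrXr (k : R) w : hinfnorm (K *m X) = k%:E ->
  axis_fnorm (Kr *m Xtf G Kr) w <=
    th * (axis_fnorm (K *m X) w + (1 + k) * x * axis_fnorm D w).
Proof.
move=> hKX.
exact (eq_ind_r
  (fun F => axis_fnorm F w <= th * (axis_fnorm (K *m X) w + (1 + k) * x * axis_fnorm D w))
  (axis_fnorm_perturbed_input Xx Dd xd1 sD sW WE w sKX sKX sX hKX hX) KrXr_E).
Qed.

Lemma axis_fnorm_KrYr (k y : R) w : hinfnorm Y = y%:E -> hinfnorm (K *m X) = k%:E ->
  axis_fnorm (Kr *m Ytf G Kr) w <=
    th * (axis_fnorm (K *m Y) w + (1 + k) * y * axis_fnorm D w).
Proof.
move=> hY hKX.
exact (eq_ind_r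
  (fun F => axis_fnorm F w <= th * (axis_fnorm (K *m Y) w + (1 + k) * y * axis_fnorm D w))
  (axis_fnorm_perturbed_input Xx Dd xd1 sD sW WE w sKX sKY stable_Y hKX hY) KrYr_E).
Qed.

End GainBounds.

(** * The LQG cost *)

Section ClosedLoopNorms.
Variable R : realType.
Local Notation C := R[i].
Local Notation toC := (real_complex R).

Lemma normc_le_fnorm n m (A : 'M[C]_(n, m)) i j : normc (A i j) <= fnorm A.
Proof.
rewrite -(@ler_pXn2r _ 2) ?nnegrE ?normc_ge0 ?fnorm_ge0 // sqr_fnorm fdotE.
rewrite (bigD1 i) //= (bigD1 j) //= Re_conjM -sqr_normc_ReIm -addrA lerDl.
apply: addr_ge0; first by apply: sumr_ge0 => k _; rewrite Re_conjM addr_ge0 ?sqr_ge0.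
by apply: sumr_ge0 => k _; apply: sumr_ge0 => l _; rewrite Re_conjM addr_ge0 ?sqr_ge0.
Qed.

(** The transfer matrices for which both norms are the intended ones. *)
Definition well_behaved p m (F : tfm R p m) : Prop :=
  [/\ real_rational F, stable_tfm F & decaying F].

Lemma well_behaved_sub p m p' m' (F : tfm R p m) (H : tfm R p' m') f g :
  (forall i j, F i j = H (f i) (g j)) -> well_behaved H -> well_behaved F.
Proof.
move=> FH [rH sH [M dH]]; split.
- by move=> i j; rewrite FH; exact: rH.
- move=> s s0; apply/regularP => i j; have [V HV] := sH s s0.
  by exists (V (f i) (g j)); rewrite FH; exact: HV.
- exists (\sum_(i < p) \sum_(j < m) M) => s s0; have n0 := normc_ge0 s.
  apply: le_trans (ler_wpM2r _ (fnorm_le_sum _)) _; first by rewrite addr_ge0.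
  rewrite mulr_suml; apply: ler_sum => i _; rewrite mulr_suml.
  apply: ler_sum => j _; apply: le_trans (dH s s0); apply: ler_wpM2r.
    by rewrite addr_ge0.
  have -> : tfm_at F s i j = tfm_at H s (f i) (g j) by rewrite !mxE FH.
  exact: normc_le_fnorm.
Qed.

Lemma well_behaved_transfer n m p (S : system R n m p) :
  hurwitz (sysA S) -> well_behaved (transfer (complexify S)).
Proof.
move=> /hurwitzP hA; split; first exact: real_rational_transfer.
  exact: stable_transfer.
exact: decaying_transfer.
Qed.

Lemma closed_loop_well_behaved n q m p (P : system R n m p) (K : system R q p m) :
  let G := transfer (complexify P) in let KK := transfer (complexify K) in
  hurwitz (closed_loop P K) ->
  [/\ 1%:M - G *m KK \in unitmx,
      well_behaved (Xtf G KK), well_behaved (Xtf G KK *m KK),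
      well_behaved (KK *m Xtf G KK) & well_behaved (KK *m Ytf G KK)].
Proof.
move=> G KK hcl; have [uGK tE] := transfer_feedback (complexify P) (complexify K).
have := @well_behaved_transfer _ _ _ (feedback P K) hcl.
rewrite complexify_feedback tE => wH; split; first exact: uGK.
- apply: (well_behaved_sub _ wH) => i j; exact: esym (block_mxEul _ _ _ _ i j).
- apply: (well_behaved_sub _ wH) => i j; exact: esym (block_mxEur _ _ _ _ i j).
- apply: (well_behaved_sub _ wH) => i j; exact: esym (block_mxEdl _ _ _ _ i j).
- apply: (well_behaved_sub _ wH) => i j; exact: esym (block_mxEdr _ _ _ _ i j).
Qed.

Lemma h2norm_well_behaved p m (F : tfm R p m) : well_behaved F ->
  h2norm F = axis_l2 (axis_fnorm F) /\ measurable_fun [set: R] (axis_fnorm F).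
Proof.
move=> [rF sF dF]; have rjw w : regular F (jw w) by apply: sF; exact: lexx.
by split; [exact: h2norm_axis_fnorm|exact: measurable_axis_fnorm].
Qed.

Lemma hinfnorm_well_behaved p m (F : tfm R p m) : well_behaved F ->
  exists2 c : R, 0 <= c & hinfnorm F = c%:E.
Proof. by move=> [_ _ /decaying_bounded[M /hinfnorm_bounded]]. Qed.

Lemma h2norm_bound p m p0 m0 p1 m1 (F : tfm R p m) (F0 : tfm R p0 m0)
    (F1 : tfm R p1 m1) (t c : R) : 0 <= t -> 0 <= c ->
  well_behaved F -> well_behaved F0 -> well_behaved F1 ->
  (forall w, axis_fnorm F w <= t * (axis_fnorm F0 w + c * axis_fnorm F1 w)) ->
  (h2norm F <= t%:E * (h2norm F0 + c%:E * h2norm F1))%E.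
Proof.
move=> t0 c0 /h2norm_well_behaved[-> mF].
move=> /h2norm_well_behaved[-> m0'] /h2norm_well_behaved[-> m1'] gle.
have mc1 : measurable_fun [set: R] (fun w => c * axis_fnorm F1 w) by exact: measurable_funM.
have ms : measurable_fun [set: R] (fun w => axis_fnorm F0 w + c * axis_fnorm F1 w).
  exact: measurable_funD.
have mt : measurable_fun [set: R] (fun w => t * (axis_fnorm F0 w + c * axis_fnorm F1 w)).
  exact: measurable_funM.
apply: le_trans (axis_l2_le mF mt _) _; first by move=> w; rewrite axis_fnorm_ge0 gle.
rewrite axis_l2Z // lee_wpmul2l ?lee_fin //.
by apply: le_trans (axis_l2D m0' mc1) _; rewrite axis_l2Z.
Qed.

Lemma h2norm_ge0 p m (F : tfm R p m) : (0 <= h2norm F)%E.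
Proof. exact: sqrte_ge0. Qed.

End ClosedLoopNorms.

Section CostArithmetic.
Variable R : realType.
Local Open Scope ereal_scope.

(** Over the reals the two sides are equal. When one of [a], ..., [d] is infinite
    so is the right-hand side; when [e] is, either it enters with a positive
    weight and the right-hand side is infinite, or all its weights vanish. *)
Lemma sum_of_squared_bounds (a b c d e : \bar R) (dl x y k : R) :
  0 <= a -> 0 <= b -> 0 <= c -> 0 <= d -> 0 <= e ->
  (0 <= dl)%R -> (0 <= x)%R -> (0 <= y)%R -> (0 <= k)%R ->
  a ^+ 2 + (b + dl%:E * a) ^+ 2 + (c + ((1 + k) * x)%:E * e) ^+ 2 +
    (d + ((1 + k) * y)%:E * e) ^+ 2 <=
  a ^+ 2 + b ^+ 2 + c ^+ 2 + d ^+ 2 +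
  (2%:E * dl%:E * a * b +
   2%:E * e * (d * y%:E + c * x%:E) * (1 + k%:E)) +
  (dl%:E ^+ 2 * a ^+ 2 +
   e ^+ 2 * (y%:E ^+ 2 + x%:E ^+ 2) * (1 + k%:E) ^+ 2).
Proof.
move=> a0 b0 c0 d0 e0 dl0 x0 y0 k0.
set S1 := (X in _ <= _ + X + _); set S2 := (X in _ <= _ + _ + X).
have k1 : 0 <= 1 + k%:E by rewrite adde_ge0 ?lee_fin.
have S10 : 0 <= S1.
  by rewrite /S1 adde_ge0 // !mule_ge0 ?adde_ge0 ?mule_ge0 ?lee_fin.
have S20 : 0 <= S2.
  by rewrite /S2 adde_ge0 // !mule_ge0 ?adde_ge0 ?expe_ge0 ?lee_fin.
have finite u v : 0 <= u -> 0 <= v -> u + v != +oo -> u != +oo /\ v != +oo :> \bar R.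
  by case: u v => [u||] [v||].
have finite_sqr z : 0 <= z -> z ^+ 2 != +oo -> exists r : R, z = r%:E.
  by case: z => [r||] //; exists r.
have [->|] := eqVneq (a ^+ 2 + b ^+ 2 + c ^+ 2 + d ^+ 2 + S1 + S2) +oo.
  by rewrite leey.
have [a2 b2] : 0 <= a ^+ 2 /\ 0 <= b ^+ 2 by split; exact: expe_ge0.
have [c2 d2] : 0 <= c ^+ 2 /\ 0 <= d ^+ 2 by split; exact: expe_ge0.
have ab2 := adde_ge0 a2 b2; have abc2 := adde_ge0 ab2 c2.
have abcd2 := adde_ge0 abc2 d2; have abcdS1 := adde_ge0 abcd2 S10.
move=> /(finite _ _ abcdS1 S20)[/(finite _ _ abcd2 S10)[sq_fin _] S2_fin].
have [sq_fin' /(finite_sqr _ d0)[rd dE]] := finite _ _ abc2 d2 sq_fin.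
have [{}sq_fin /(finite_sqr _ c0)[rc cE]] := finite _ _ ab2 c2 sq_fin'.
have [/(finite_sqr _ a0)[ra aE] /(finite_sqr _ b0)[rb bE]] := finite _ _ a2 b2 sq_fin.
have [ee|e_fin] := eqVneq e +oo; last first.
  have [re eE] : exists r, e = r%:E by case: (e) e0 e_fin => [r||] //; exists r.
  rewrite /S1 /S2 aE bE cE dE eE -!(EFinD, EFinM, EFin_expe) lee_fin.
  by rewrite le_eqVlt; apply/orP; left; apply/eqP; ring.
have xy : (y ^+ 2 + x ^+ 2 = 0)%R.
  apply/eqP/contraT => xy_neq0; move: S2_fin; rewrite /S2.
  have xy_gt0 : 0 < y%:E ^+ 2 + x%:E ^+ 2.
    by rewrite -!EFin_expe -EFinD lte_fin lt_neqAle eq_sym xy_neq0 addr_ge0 ?sqr_ge0.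
  have k_gt0 : 0 < (1 + k%:E) ^+ 2.
    by rewrite expe_gt0 // -EFinD lte_fin ltr_pwDl.
  have -> : e ^+ 2 = +oo by rewrite ee expe2 mulyy.
  rewrite (gt0_mulye xy_gt0) (gt0_mulye k_gt0) addey //.
  by rewrite aE -!EFin_expe -EFinM.
have {}xy : x = 0%R /\ y = 0%R.
  by move/eqP: xy; rewrite paddr_eq0 ?sqr_ge0 // !sqrf_eq0 => /andP[/eqP -> /eqP ->].
rewrite /S1 /S2; case: xy => -> ->.
have z2 : 0 ^+ 2 = 0 :> \bar R by rewrite expe2 mule0.
rewrite !(mulr0, mule0, mul0e, adde0, z2).
rewrite aE bE cE dE -!(EFinD, EFinM, EFin_expe) lee_fin.
by rewrite le_eqVlt; apply/orP; left; apply/eqP; ring.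
Qed.

(** [N1], ..., [N4] stand for the H2 norms of the perturbed closed loop, [a], [b],
    [c], [d], [e] for those of [X], [X K], [K X], [K Y], [D], and [hx], [hy],
    [hd], [hk] for the H-infinity norms of [X], [Y], [D], [K X]. *)
Lemma cost_inequality (N1 N2 N3 N4 a b c d e hx hy hd hk : \bar R) (x y dl k : R) :
  (0 <= x)%R -> (0 <= y)%R -> (0 <= dl)%R -> (0 <= k)%R -> (x * dl < 1)%R ->
  hx = x%:E -> hy = y%:E -> hd = dl%:E -> hk = k%:E ->
  0 <= a -> 0 <= b -> 0 <= c -> 0 <= d -> 0 <= e ->
  0 <= N1 -> 0 <= N2 -> 0 <= N3 -> 0 <= N4 ->
  let th := ((1 - x * dl)^-1)%:E in
  N1 <= th * a -> N2 <= th * (b + dl%:E * a) ->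
  N3 <= th * (c + ((1 + k) * x)%:E * e) -> N4 <= th * (d + ((1 + k) * y)%:E * e) ->
  N1 ^+ 2 + N2 ^+ 2 + N3 ^+ 2 + N4 ^+ 2 <=
  1 / (1 - hx * hd) ^+ 2 * (a ^+ 2 + b ^+ 2 + c ^+ 2 + d ^+ 2 +
  (2%:E * hd * a * b + 2%:E * e * (d * hy + c * hx) * (1 + hk)) +
  (hd ^+ 2 * a ^+ 2 + e ^+ 2 * (hy ^+ 2 + hx ^+ 2) * (1 + hk) ^+ 2)).
Proof.
move=> x0 y0 dl0 k0 xd1 -> -> -> -> a0 b0 c0 d0 e0 N10 N20 N30 N40 th b1 b2 b3 b4.
have th0 : (0 <= (1 - x * dl)^-1)%R by rewrite invr_ge0 subr_ge0 ltW.
have -> : 1 / (1 - x%:E * dl%:E) ^+ 2 = th ^+ 2.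
  rewrite -EFinM -EFinB -EFin_expe inver mul1e /th -EFin_expe.
  by rewrite sqrf_eq0 subr_eq0 eq_sym lt_eqF // exprVn.
have sqr_bound (N u : \bar R) : 0 <= N -> N <= th * u -> N ^+ 2 <= th ^+ 2 * u ^+ 2.
  by move=> N0 Nu; rewrite !expe2 muleACA; exact: lee_pmul.
apply: le_trans (leeD (leeD (leeD (sqr_bound _ _ N10 b1) (sqr_bound _ _ N20 b2))
  (sqr_bound _ _ N30 b3)) (sqr_bound _ _ N40 b4)) _.
have kx0 : (0 <= (1 + k) * x)%R by rewrite mulr_ge0 // addr_ge0.
have ky0 : (0 <= (1 + k) * y)%R by rewrite mulr_ge0 // addr_ge0.
rewrite -!ge0_muleDr ?adde_ge0 ?expe_ge0 ?adde_ge0 ?mule_ge0 ?lee_fin //.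
rewrite lee_wpmul2l ?expe_ge0 ?lee_fin //.
exact: sum_of_squared_bounds.
Qed.

End CostArithmetic.

Section CostBound.
Variable R : realType.

(** The quotient is infinite when [X] has norm 0, in which case the product of the
    two norms is 0. *)
Lemma small_gain_constants p m (X : tfm R p m) (D : tfm R m p) :
  decaying X -> decaying D -> (hinfnorm D < 1 / hinfnorm X)%E ->
  exists x d : R, [/\ 0 <= x, 0 <= d, hinfnorm X = x%:E, hinfnorm D = d%:E & x * d < 1].
Proof.
move=> /decaying_bounded[M /hinfnorm_bounded[x x0 hX]].
move=> /decaying_bounded[N /hinfnorm_bounded[d d0 hD]] XD.
exists x, d; split=> //; move: XD; rewrite hD hX inver mul1e.
have [->|x_neq0] := eqVneq x 0; first by rewrite mul0r.
rewrite lte_fin -[_^-1]mul1r ltr_pdivlMr; first by rewrite mulrC.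
by rewrite lt_neqAle eq_sym x_neq0.
Qed.

Variables (p m : nat) (G : tfm R p m) (K D : tfm R m p).
Hypothesis uGK : 1%:M - G *m K \in unitmx.
Local Notation X := (Xtf G K).
Local Notation Y := (Ytf G K).
Hypotheses (wX : well_behaved X) (wXK : well_behaved (X *m K))
  (wKX : well_behaved (K *m X)) (wKY : well_behaved (K *m Y)) (wD : well_behaved D).
Hypothesis smallD : (hinfnorm D < 1 / hinfnorm X)%E.

Lemma hinfnorm_Y : exists2 y : R, 0 <= y & hinfnorm Y = y%:E.
Proof.
have [_ sXK /decaying_bounded[M XKM]] := wXK.
apply: (@hinfnorm_bounded _ _ _ _ (fnorm (1%:M : 'M[R[i]]_p) + M)) => w.
have w0 : 0 <= complex.Re (jw w) by exact: lexx.
have e := tfm_atD (@stable_tfm1 R p _ w0) (sXK _ w0).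
rewrite (output_sensitivity uGK) /axis_fnorm e tfm_at1.
by apply: le_trans (fnormD _ _) _; rewrite lerD2l; exact: XKM.
Qed.

Lemma perturbed_stable : let Kr := K - D in
  [/\ stable_tfm (Xtf G Kr), stable_tfm (Xtf G Kr *m Kr),
      stable_tfm (Kr *m Xtf G Kr) & stable_tfm (Kr *m Ytf G Kr)].
Proof.
have [[_ sX dX] [_ sXK _] [_ sKX _]] := And3 wX wXK wKX.
have [[_ sKY _] [_ sD dD]] := conj wKY wD.
have [x [d [x0 d0 hX hD xd1]]] := small_gain_constants dX dD smallD.
exact (perturbed_loop_stable uGK sX sXK sKX sKY sD dX dD x0 hX hD xd1).
Qed.

Theorem lqg_cost_perturbed (Kr : tfm R m p) : Kr = K - D ->
  well_behaved (Xtf G Kr) -> well_behaved (Xtf G Kr *m Kr) ->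
  well_behaved (Kr *m Xtf G Kr) -> well_behaved (Kr *m Ytf G Kr) ->
  (lqg_cost G Kr <= 1 / (1 - hinfnorm X * hinfnorm D) ^+ 2 * (lqg_cost G K +
    (2%:E * hinfnorm D * h2norm X * h2norm (X *m K) +
     2%:E * h2norm D * (h2norm (K *m Y) * hinfnorm Y + h2norm (K *m X) * hinfnorm X) *
       (1 + hinfnorm (K *m X))) +
    (hinfnorm D ^+ 2 * h2norm X ^+ 2 +
     h2norm D ^+ 2 * (hinfnorm Y ^+ 2 + hinfnorm X ^+ 2) *
       (1 + hinfnorm (K *m X)) ^+ 2)))%E.
Proof.
move=> KrE wXr wXrKr wKrXr wKrYr.
have [[_ sX dX] [_ sXK _] [_ sKX _]] := And3 wX wXK wKX.
have [[_ sKY _] [_ sD dD]] := conj wKY wD.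
have [x [d [x0 d0 hX hD xd1]]] := small_gain_constants dX dD smallD.
have [y y0 hY] := hinfnorm_Y; have [k k0 hKX] := hinfnorm_well_behaved wKX.
set th := (1 - x * d)^-1.
have th_ge0 : 0 <= th by rewrite invr_ge0 subr_ge0 ltW.
have [gXr gXrKr gKrXr gKrYr] : [/\ forall w, axis_fnorm (Xtf G Kr) w <= th * axis_fnorm X w,
    forall w, axis_fnorm (Xtf G Kr *m Kr) w <=
      th * (axis_fnorm (X *m K) w + d * axis_fnorm X w),
    forall w, axis_fnorm (Kr *m Xtf G Kr) w <=
      th * (axis_fnorm (K *m X) w + (1 + k) * x * axis_fnorm D w) &
    forall w, axis_fnorm (Kr *m Ytf G Kr) w <=
      th * (axis_fnorm (K *m Y) w + (1 + k) * y * axis_fnorm D w)].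
  rewrite KrE; split=> w.
  - exact (axis_fnorm_Xr uGK sX sD dX dD x0 hX hD xd1 w).
  - exact (axis_fnorm_XrKr uGK sX sXK sD dX dD x0 hX hD xd1 w).
  - exact (axis_fnorm_KrXr uGK sX sKX sD dX dD x0 hX hD xd1 w hKX).
  - exact (axis_fnorm_KrYr uGK sX sXK sKX sKY sD dX dD x0 hX hD xd1 w hY hKX).
have bXr : (h2norm (Xtf G Kr) <= th%:E * h2norm X)%E.
  have h w : axis_fnorm (Xtf G Kr) w <= th * (axis_fnorm X w + 0 * axis_fnorm X w).
    by rewrite mul0r addr0.
  by have := h2norm_bound th_ge0 (lexx (0 : R)) wXr wX wX h; rewrite mul0e adde0.
have bXrKr := h2norm_bound th_ge0 d0 wXrKr wXK wX gXrKr.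
have kx0 : 0 <= (1 + k) * x by rewrite mulr_ge0 // addr_ge0.
have ky0 : 0 <= (1 + k) * y by rewrite mulr_ge0 // addr_ge0.
have bKrXr := h2norm_bound th_ge0 kx0 wKrXr wKX wD gKrXr.
have bKrYr := h2norm_bound th_ge0 ky0 wKrYr wKY wD gKrYr.
rewrite /lqg_cost.
exact (cost_inequality x0 y0 d0 k0 xd1 hX hY hD hKX (h2norm_ge0 _) (h2norm_ge0 _)
  (h2norm_ge0 _) (h2norm_ge0 _) (h2norm_ge0 _) (h2norm_ge0 _) (h2norm_ge0 _)
  (h2norm_ge0 _) (h2norm_ge0 _) bXr bXrKr bKrXr bKrYr).
Qed.

End CostBound.

Theorem corollary2 (R : realType) (nx m p n n1 n2 r : nat)
  (P : system R nx m p) (K : system R n p m)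
  (Klt : system R n1 p m) (Kge : system R n2 p m) (Krlt : tfm R m p)
  (minP : minimal P) (minK : minimal K)
  (stabK : hurwitz (closed_loop P K))
  (sepK : stable_unstable_separation K Klt Kge)
  (truncK : modal_truncation r Klt Krlt) :
  let G := transfer (complexify P) in
  let KK := transfer (complexify K) in
  let Kr := Krlt + transfer (complexify Kge) in
  let Delta := transfer (complexify Klt) - Krlt in
  let Y := Ytf G KK in
  let X := Xtf G KK in
  let S1 := (2%:E * hinfnorm Delta * h2norm X * h2norm (X *m KK) +
             2%:E * h2norm Delta *
               (h2norm (KK *m Y) * hinfnorm Y + h2norm (KK *m X) * hinfnorm X) *
               (1 + hinfnorm (KK *m X)))%E in
  let S2 := (hinfnorm Delta ^+ 2 * h2norm X ^+ 2 +
             h2norm Delta ^+ 2 * (hinfnorm Y ^+ 2 + hinfnorm X ^+ 2) *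
               (1 + hinfnorm (KK *m X)) ^+ 2)%E in
  real_rational Kr ->
  (hinfnorm Delta < 1 / hinfnorm X)%E ->
  internally_stabilizes P Kr /\
  (lqg_cost G Kr <=
     1 / (1 - hinfnorm X * hinfnorm Delta) ^+ 2 * (lqg_cost G KK + S1 + S2))%E.
Proof.
move=> G KK Kr Delta Y X S1 S2 rKr smallD.
have [simK hKlt _] := sepK.
have [rF sD dD] := modal_truncation_error hKlt truncK.
have KKE : KK = transfer (complexify Klt) + transfer (complexify Kge).
  exact: transfer_separation sepK.
have KrE : Kr = KK - Delta.
  by rewrite /Kr /Delta KKE opprB [RHS]addrC addrA subrK.
have [uGK wX wXK wKX wKY] := closed_loop_well_behaved stabK.
have wD : well_behaved Delta.
  split; [|exact: sD|exact: dD].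
  have -> : Delta = KK - Kr by rewrite KrE opprB addrC subrK.
  exact: real_rationalB (real_rational_transfer K) rKr.
have [sXr sXrKr sKrXr sKrYr] : [/\ stable_tfm (Xtf G Kr), stable_tfm (Xtf G Kr *m Kr),
    stable_tfm (Kr *m Xtf G Kr) & stable_tfm (Kr *m Ytf G Kr)].
  by rewrite KrE; exact (perturbed_stable uGK wX wXK wKX wKY wD smallD).
have stabKr : internally_stabilizes P Kr.
  apply: (internally_stabilizes_stable minP _ rKr sXr sXrKr sKrXr sKrYr).
  by apply: realizableD rF _; exists n2, (complexify Kge).
split; first exact: stabKr.
have [q [S [_ SE stabS]]] := stabKr.
have := closed_loop_well_behaved stabS; rewrite SE => -[_ wXr wXrKr wKrXr wKrYr].
exact (lqg_cost_perturbed uGK wX wXK wKX wKY wD smallD KrE wXr wXrKr wKrXr wKrYr).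
Qed.
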